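(* Let $n\ge 1$, let $\Omega\subset\mathbf{R}^n$ be a bounded convex domain with $C^2$ boundary and outer unit normal $\mathbf{n}$ on $\partial\Omega$, let $T>0$, and set $\Omega_T=\Omega\times(0,T]$. Let $\Lambda\ge\lambda>0$ and let $f\in C^3([0,\infty))$ satisfy $\lambda\le f(s)+2sf'(s)\le\Lambda$ for all $s\ge 0$; define $\sigma:\mathbf{R}^n\to\mathbf{R}^n$ by $\sigma(p)=f(|p|^2)p$. Let $n+2<q_0<\infty$ and let $c=c(t)\in W^{1,q_0}(0,T)$ be nonnegative. Let $u_0\in C^2(\bar\Omega)$ satisfy $\partial u_0/\partial\mathbf{n}=0$ on $\partial\Omega$. If $u\in C^{2,1}(\bar\Omega_T)$ is a classical solution to $$\begin{cases} u_t=\operatorname{div}(\sigma(Du))-c(t)u & \text{in } \Omega\times(0,T],\\ \partial u/\partial\mathbf{n}=0 & \text{on } \partial\Omega\times(0,T],\\ u(x,0)=u_0(x) & \text{for } x\in\Omega,\end{cases}$$ then $$\|Du\|_{L^\infty(\Omega_T)}=\|Du_0\|_{L^\infty(\Omega)}.$$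
   Context: $u=u(x,t)$ is real-valued, $u_t$ is its time derivative, and $Du=(u_{x_1},\dots,u_{x_n})$ denotes its spatial gradient; $\operatorname{div}$ is the divergence in $x$. $\bar\Omega_T=\bar\Omega\times[0,T]$. For integers $k,l\ge 0$ with $2l\le k$, $C^{k,l}(\bar\Omega_T)$ is the space of functions $u\in C^0(\bar\Omega_T)$ such that $D_x^aD_t^ju\in C^0(\bar\Omega_T)$ for all multiindices $|a|\le k$ and integers $0\le j\le l$ with $|a|+2j\le k$. A function $c\in W^{1,q_0}(0,T)$ is identified with its continuous representative on $[0,T]$. *)

(* Defs.v *)
From HB Require Import structures.
From mathcomp Require Import all_boot all_order all_algebra.
From mathcomp Require Import all_classical all_reals all_analysis.

Set Implicit Arguments.
Unset Strict Implicit.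
Unset Printing Implicit Defensive.

Import Order.TTheory GRing.Theory Num.Theory.
Import numFieldNormedType.Exports.

Local Open Scope classical_set_scope.
Local Open Scope ring_scope.

(* The topology of 'rV[R]_n is the one of the library's sup norm; the length
   |p| of a vector is Euclidean. *)
Definition dotv (R : realType) (n : nat) (p q : 'rV[R]_n) : R :=
  \sum_(i < n) p 0 i * q 0 i.

Definition enorm (R : realType) (n : nat) (p : 'rV[R]_n) : R :=
  Num.sqrt (dotv p p).

Definition sigma (R : realType) (n : nat) (f : R -> R) (p : 'rV[R]_n) :
  'rV[R]_n := f (enorm p ^+ 2) *: p.

(* D_{v_1} (... (D_{v_m} u)) for vs = [:: v_1; ...; v_m], and the assertion that
   each of these successive derivatives exists on A. *)
Definition iterD (R : realType) (V : normedModType R) (vs : seq V)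
    (u : V -> R) : V -> R :=
  foldr (fun v g x => 'D_v g x) u vs.

Fixpoint iterD_exists (R : realType) (V : normedModType R) (A : set V)
    (vs : seq V) (u : V -> R) : Prop :=
  if vs is v :: vs' then
    iterD_exists A vs' u /\ forall x, A x -> derivable (iterD vs' u) x v
  else True.

(* For A `<=` B `<=` closure A: g, restricted to A, is continuous and extends
   continuously to B.  (At x in A the filter contains x itself, so the limit
   can only be g x.) *)
Definition extends_continuously (R : realType) (V : normedModType R)
    (A B : set V) (g : V -> R) : Prop :=
  forall x, B x -> cvg (g @ within A (nbhs x)).

Definition iterD_continuous (R : realType) (V : normedModType R)
    (A B : set V) (vs : seq V) (u : V -> R) : Prop :=
  iterD_exists A vs u /\ extends_continuously A B (iterD vs u).

(* The derivative D_v u, taken in the open set A and extended by continuity to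
   closure A; on A it is the usual derivative when that one is continuous. *)
Definition Dbar (R : realType) (V : normedModType R) (A : set V) (v : V)
    (u : V -> R) (x : V) : R :=
  lim ((fun y => 'D_v u y) @ within A (nbhs x)).

Definition basis_vec (R : realType) (n : nat) (i : 'I_n) : 'rV[R]_n :=
  delta_mx 0 i.

Definition dir_x (R : realType) (n : nat) (i : 'I_n) : ('rV[R]_n * R)%type :=
  (basis_vec R i, 0).

Definition dir_t (R : realType) (n : nat) : ('rV[R]_n * R)%type := (0, 1).

(* In the following classes a derivative D^a with |a| <= k is encoded by a list
   of at most k coordinate directions; all orders of differentiation are
   allowed. *)
Definition C_open (R : realType) (n : nat) (U : set 'rV[R]_n) (k : nat)
    (u : 'rV[R]_n -> R) : Prop :=
  forall s : seq 'I_n, (size s <= k)%N ->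
    iterD_continuous U U [seq basis_vec R i | i <- s] u.

Definition C_closure (R : realType) (n : nat) (Omega : set 'rV[R]_n) (k : nat)
    (u : 'rV[R]_n -> R) : Prop :=
  {within closure Omega, continuous u} /\
  forall s : seq 'I_n, (size s <= k)%N ->
    iterD_continuous Omega (closure Omega) [seq basis_vec R i | i <- s] u.

Definition pos_reals (R : realType) : set R := `]0, +oo[.

Definition C_nonneg (R : realType) (k : nat) (f : R -> R) : Prop :=
  {within closure (@pos_reals R), continuous f} /\
  forall j : nat, (j <= k)%N ->
    iterD_continuous (@pos_reals R) (closure (@pos_reals R))
      (nseq j (1 : R)) f.

Definition open_cylinder (R : realType) (n : nat) (Omega : set 'rV[R]_n)
    (T : R) : set ('rV[R]_n * R) := Omega `*` `]0, T[.

Definition parabolic_cylinder (R : realType) (n : nat) (Omega : set 'rV[R]_n)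
    (T : R) : set ('rV[R]_n * R) := Omega `*` `]0, T].

Definition closed_cylinder (R : realType) (n : nat) (Omega : set 'rV[R]_n)
    (T : R) : set ('rV[R]_n * R) := closure Omega `*` `[0, T].

Definition C_parabolic (R : realType) (n : nat) (Omega : set 'rV[R]_n) (T : R)
    (k l : nat) (u : 'rV[R]_n * R -> R) : Prop :=
  {within closed_cylinder Omega T, continuous u} /\
  forall (s : seq 'I_n) (j : nat), (j <= l)%N -> (size s + 2 * j <= k)%N ->
    iterD_continuous (open_cylinder Omega T) (closed_cylinder Omega T)
      ([seq dir_x R i | i <- s] ++ nseq j (dir_t R n)) u.

Definition grad (R : realType) (n : nat) (u : 'rV[R]_n -> R) (x : 'rV[R]_n) :
  'rV[R]_n := \row_i 'D_(basis_vec R i) u x.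

Definition grad_bar (R : realType) (n : nat) (Omega : set 'rV[R]_n)
    (u : 'rV[R]_n -> R) (x : 'rV[R]_n) : 'rV[R]_n :=
  \row_i Dbar Omega (basis_vec R i) u x.

Definition Dx (R : realType) (n : nat) (Omega : set 'rV[R]_n) (T : R)
    (u : 'rV[R]_n * R -> R) (z : 'rV[R]_n * R) : 'rV[R]_n :=
  \row_i Dbar (open_cylinder Omega T) (dir_x R i) u z.

Definition Dt (R : realType) (n : nat) (Omega : set 'rV[R]_n) (T : R)
    (u : 'rV[R]_n * R -> R) (z : 'rV[R]_n * R) : R :=
  Dbar (open_cylinder Omega T) (dir_t R n) u z.

Definition divergence (R : realType) (n : nat) (F : 'rV[R]_n -> 'rV[R]_n)
    (x : 'rV[R]_n) : R :=
  \sum_(i < n) 'D_(basis_vec R i) (fun y => F y 0 i) x.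

Definition frontier (R : realType) (n : nat) (Omega : set 'rV[R]_n) :
  set 'rV[R]_n := closure Omega `\` interior Omega.

Definition is_domain (R : realType) (n : nat) (Omega : set 'rV[R]_n) : Prop :=
  [/\ open Omega, Omega !=set0 & connected Omega].

(* Near x, Omega is {rho < 0} with rho of class C^2 and regular; on the boundary
   grad rho then points outwards. *)
Definition C2_defining_function (R : realType) (n : nat)
    (Omega : set 'rV[R]_n) (x : 'rV[R]_n) (U : set 'rV[R]_n)
    (rho : 'rV[R]_n -> R) : Prop :=
  [/\ open U /\ U x,
      C_open U 2 rho,
      forall y, U y -> grad rho y != 0 &
      forall y, U y -> (Omega y <-> rho y < 0)].

Definition C2_boundary (R : realType) (n : nat) (Omega : set 'rV[R]_n) :
  Prop :=
  forall x, frontier Omega x ->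
    exists U rho, C2_defining_function Omega x U rho.

Definition outer_unit_normal (R : realType) (n : nat) (Omega : set 'rV[R]_n)
    (nu : 'rV[R]_n -> 'rV[R]_n) : Prop :=
  forall x, frontier Omega x ->
    exists U rho, C2_defining_function Omega x U rho /\
      nu x = (enorm (grad rho x))^-1 *: grad rho x.

Definition test_function (R : realType) (a b : R) (phi : R -> R) : Prop :=
  (forall (k : nat) (x : R), derivable (phi^`(k))%classic x 1) /\
  exists a' b' : R, [/\ a < a', b' < b &
    forall x, phi x != 0 -> a' <= x <= b'].

Definition in_Lq (R : realType) (a b q : R) (g : R -> R) : Prop :=
  (g \_ `]a, b[) \in Lfun (@lebesgue_measure R) q%:E.

Definition in_W1q (R : realType) (a b q : R) (c : R -> R) : Prop :=
  in_Lq a b q c /\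
  exists g : R -> R, in_Lq a b q g /\
    forall phi, test_function a b phi ->
      \int[@lebesgue_measure R]_(t in `]a, b[) (c t * (phi^`())%classic t) =
      - \int[@lebesgue_measure R]_(t in `]a, b[) (g t * phi t).

Definition box (R : realType) (m : nat) (a b : 'rV[R]_m) : set 'rV[R]_m :=
  [set x | forall i, a 0 i < x 0 i < b 0 i].

(* Lebesgue measure on R^m is not in the library; its null sets are those that
   have countable covers by boxes of arbitrarily small total volume. *)
Definition lebesgue_null (R : realType) (m : nat) (N : set 'rV[R]_m) : Prop :=
  forall e : R, 0 < e ->
    exists a b : nat -> 'rV[R]_m,
      [/\ forall k i, a k 0 i <= b k 0 i,
          N `<=` \bigcup_k box (a k) (b k) &
          (\sum_(0 <= k <oo) (\prod_(i < m) (b k 0 i - a k 0 i))%:E <= e%:E)%E].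

(* Infimum of the essential bounds of |F| on A, +oo if there is none. *)
Definition Linfty_norm (R : realType) (m : nat) (A : set 'rV[R]_m)
    (F : 'rV[R]_m -> R) : \bar R :=
  ereal_inf [set M%:E | M in
    [set M : R | 0 <= M /\ lebesgue_null (A `&` [set x | M < `|F x|])]].

(* R^{n+1} = R^n x R, the last coordinate being time. *)
Definition space_time (R : realType) (n : nat) (z : 'rV[R]_(n + 1)) :
  'rV[R]_n * R := (lsubmx z, rsubmx z 0 0).

Definition Linfty_norm_xt (R : realType) (n : nat) (A : set ('rV[R]_n * R))
    (F : 'rV[R]_n * R -> R) : \bar R :=
  Linfty_norm (@space_time R n @^-1` A) (F \o @space_time R n).

Definition classical_solution (R : realType) (n : nat) (Omega : set 'rV[R]_n)
    (T : R) (nu : 'rV[R]_n -> 'rV[R]_n) (f c : R -> R) (u0 : 'rV[R]_n -> R)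
    (u : 'rV[R]_n * R -> R) : Prop :=
  [/\ forall x t, Omega x -> 0 < t <= T ->
        Dt Omega T u (x, t) =
          divergence (fun y => sigma f (Dx Omega T u (y, t))) x
          - c t * u (x, t),
      forall x t, frontier Omega x -> 0 < t <= T ->
        dotv (Dx Omega T u (x, t)) (nu x) = 0 &
      forall x, Omega x -> u (x, 0) = u0 x].

(* Main.v *)
Require Import Defs.
From HB Require Import structures.
From mathcomp Require Import all_boot all_order all_algebra.
From mathcomp Require Import all_classical all_reals all_analysis.
From mathcomp Require Import measurable_realfun ring lra.

Import Order.TTheory GRing.Theory Num.Theory.
Import numFieldNormedType.Exports.

Set Implicit Arguments.
Unset Strict Implicit.
Unset Printing Implicit Defensive.

Local Open Scope classical_set_scope.
Local Open Scope ring_scope.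

(** On a convex domain, a bound on the gradient is the same as a Lipschitz bound
    with the same constant, so the theorem says that the best Lipschitz constant
    of [u(., t)] never exceeds that of [u0]; the opposite inequality comes from
    letting [t] tend to 0. Working with Lipschitz constants rather than with
    [|Du|^2] avoids third derivatives of [u], which a solution of class C^{2,1}
    need not have.

    The Lipschitz constant [L] is preserved by a two-point maximum principle
    ([lipschitz_preserved]). Suppose that [u(x, t) - u(y, t) - L |x - y|] has a
    positive maximum over pairs of points of the closed domain and over times.
    If [x] and [y] are interior, then [Du(x) = Du(y) = L (x - y) / |x - y|], so
    the coefficients a_ij(Du) of the equation in nondivergence form agree at the
    two points; moving both points by the same vector leaves [|x - y|] fixed and
    yields D^2 u(x) <= D^2 u(y) ([touching_hess]). Ellipticity then gives
    [u_t(x) - u_t(y) <= - c (u(x) - u(y)) <= 0], against a maximum in time once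
    [eps * t] has been subtracted. Points on the boundary are excluded by the
    Neumann condition together with convexity, for which [(x - y) . nu(x) >= 0]
    ([touching_interior_x]). Since that inequality need not be strict, a term
    [delta (|x - x0|^2 + |y - x0|^2) / 2] with [x0] interior is subtracted as
    well; it moves the two gradients apart by O(delta), which is paid for by the
    continuity of the coefficients ([coef_close]) and the boundedness of the
    second derivatives ([hess_bounded]).

    At the maximum point [L |x - y|] is bounded above by a quadratic in [x - y]
    with contact ([enorm_shift_le]), so that all first and second order conditions
    reduce to functions of one variable below a parabola ([parabola_touch]).

    The essential suprema are genuine suprema because the gradients are
    continuous and no neighbourhood is covered by boxes of arbitrarily small total
    volume ([not_lebesgue_null_ball]). The two norms are infima over sets of
    bounds [M], and these sets coincide: each consists of the [M >= 0] that are
    Lipschitz constants of [u0]. *)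

(** * Derivatives along a direction, and maxima of functions of one variable *)

Section directional.
Variables (R : realType) (V : normedModType R).
Implicit Types (g : V -> R) (a x v w : V).

(** The quantified form of differentiability used throughout: the error is at
    most [e * |h|], with no quotient and no exclusion of [h = 0]. *)
Lemma is_derive_epsP g x v (D : R) :
  is_derive x v g D <->
  forall e : R, 0 < e -> exists2 r : R, 0 < r &
    forall h : R, `|h| < r -> `|g (x + h *: v) - g x - h * D| <= e * `|h|.
Proof.
have E : is_derive x v g D <->
    (fun h : R => h^-1 *: ((g \o shift x) (h *: v) - g x)) @ 0^' --> D.
  split; first by case=> dg <-.
  move=> H; apply: DeriveDef; first by apply/cvg_ex; exists D.
  exact: (cvg_lim (@Rhausdorff R)).
rewrite E; split.
  move=> /cvgrPdist_le H e e0.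
  have [r /= r0 Hr] := H e e0; exists r => // h hr.
  have [->|h0] := eqVneq h 0.
    by rewrite scale0r addr0 subrr mul0r subr0 normr0 mulr0.
  have := Hr h; rewrite /= sub0r normrN => /(_ hr h0).
  rewrite [h *: v + x]addrC /GRing.scale /= => Hh.
  have -> : g (x + h *: v) - g x - h * D =
      - h * (D - h^-1 * (g (x + h *: v) - g x)) by field.
  by rewrite normrM normrN mulrC ler_wpM2r.
move=> H; apply/cvgrPdist_le => e e0.
have [r r0 Hr] := H e e0; exists r => // h /=.
rewrite sub0r normrN => /Hr + h0; rewrite [h *: v + x]addrC /GRing.scale /=.
have -> : g (x + h *: v) - g x - h * D =
    - h * (D - h^-1 * (g (x + h *: v) - g x)) by field.
by rewrite normrM normrN mulrC ler_pM2r // normr_gt0.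
Qed.

Lemma is_derive_line g a v (s D : R) :
  is_derive (a + s *: v) v g D ->
  is_derive s (1 : R) (fun r : R => g (a + r *: v)) D.
Proof.
move=> [dg <-]; rewrite /derive /derivable in dg *.
have E : (fun h : R => h^-1 *: (((fun r : R => g (a + r *: v)) \o shift s) (h *: 1)
     - g (a + s *: v))) =
   (fun h : R => h^-1 *: ((g \o shift (a + s *: v)) (h *: v) - g (a + s *: v))).
  apply/funext => h /=; congr (_ *: (g _ - _)).
  by rewrite [h *: 1]mulr1 scalerDl addrCA.
by apply: DeriveDef; rewrite /derive /derivable E.
Qed.

Lemma is_derive_cont_line g a v (s D : R) :
  is_derive (a + s *: v) v g D ->
  {for s, continuous (fun r : R => g (a + r *: v))}.
Proof.
move=> /is_derive_line [dg _].
exact/differentiable_continuous/derivable1_diffP.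
Qed.

(** Only continuity is asked at the endpoints of the segment, so that the base
    point [a] may lie on the boundary of the set where [g] is differentiable. *)
Lemma mvt_line g a v (b : R) : 0 < b ->
  (forall s : R, 0 < s < b -> derivable g (a + s *: v) v) ->
  {within `[0, b], continuous (fun s : R => g (a + s *: v))} ->
  exists2 s : R, 0 < s < b & g (a + b *: v) - g a = b * 'D_v g (a + s *: v).
Proof.
move=> b0 dg cg.
have [|c] := @MVT R _ (fun s : R => 'D_v g (a + s *: v)) 0 b b0 _ cg.
  by move=> s; rewrite in_itv /= => /dg /derivableP; exact: is_derive_line.
rewrite in_itv /= scale0r addr0 subr0 mulrC => cb E; exists c => //.
Qed.

Lemma mvt_line_in g a v (b : R) : 0 < b ->
  (forall s : R, 0 <= s <= b -> derivable g (a + s *: v) v) ->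
  exists2 s : R, 0 < s < b & g (a + b *: v) - g a = b * 'D_v g (a + s *: v).
Proof.
move=> b0 dg; apply: mvt_line => // [s /andP[s0 sb]|].
  by apply: dg; rewrite !ltW.
apply: continuous_in_subspaceT => s; rewrite inE /= in_itv /= => sb.
by have /derivableP/is_derive_cont_line := dg s sb.
Qed.

Lemma mvt_line_sym g a v (h : R) :
  (forall s : R, `|s| <= `|h| -> derivable g (a + s *: v) v) ->
  exists2 s : R, `|s| <= `|h| & g (a + h *: v) - g a = h * 'D_v g (a + s *: v).
Proof.
move=> dg; have [h0|h0|->] := ltgtP h 0.
- have [||s sb E] := @mvt_line_in g (a + h *: v) v (- h).
  + by rewrite oppr_gt0.
  + move=> s /andP[s0 sh]; rewrite -addrA -scalerDl; apply: dg.
    by rewrite (ltr0_norm h0) ler_norml; apply/andP; split; lra.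
  exists (h + s).
    by rewrite (ltr0_norm h0) ler_norml; move: sb => /andP[? ?]; apply/andP; split; lra.
  move: E; rewrite -!addrA -!scalerDl subrr scale0r addr0 => E.
  by rewrite -opprB E mulNr opprK.
- have [s sb|s sb E] := @mvt_line_in g a v h h0.
    by apply: dg; move: sb => /andP[? ?]; rewrite !ger0_norm // ltW.
  by exists s => //; move: sb => /andP[? ?]; rewrite !ger0_norm // ltW.
exists 0; first by rewrite normr0.
by rewrite scale0r addr0 subrr mul0r.
Qed.

(** Total differentiability is avoided by adding one direction at a time: the
    increment along [w] is a derivative at a nearby point by the mean value
    theorem, and continuity of that one derivative controls it. *)
Lemma is_derive_addZ g x v w (c D : R) :
  is_derive x v g D ->
  (\forall y \near x, derivable g y w) ->
  {for x, continuous ('D_w g)} ->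
  is_derive x (v + c *: w) g (D + c * 'D_w g x).
Proof.
move=> /is_derive_epsP dv dw cw; apply/is_derive_epsP => e e0.
pose K := `|v| + `|c| * `|w| + 1.
have K0 : 0 < K by rewrite ltr_wpDl// addr_ge0 ?mulr_ge0.
pose e' := e / 2 / (`|c| + 1).
have c1 : 0 < `|c| + 1 by rewrite ltr_wpDl.
have e'0 : 0 < e' by rewrite !divr_gt0.
have [r r0 Hr] := dv (e / 2) (divr_gt0 e0 (ltr0Sn _ 1)).
have [r2 /= r20 Hr2] : exists2 r : R, 0 < r & forall y, `|x - y| < r ->
    derivable g y w /\ `|'D_w g x - 'D_w g y| <= e'.
  have cw' : \forall y \near x, `|'D_w g x - 'D_w g y| <= e'.
    by move: cw => /cvgrPdist_le /(_ _ e'0).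
  have : nbhs x (fun y => derivable g y w /\ `|'D_w g x - 'D_w g y| <= e').
    exact: filterI dw cw'.
  move=> /nbhs_ballP[s /= s0 Hs].
  by exists s => // y xy; apply: Hs; rewrite -ball_normE.
exists (Num.min r (r2 / K)); first by rewrite lt_min r0 divr_gt0.
move=> h; rewrite lt_min => /andP[/Hr H1 hr2].
have near_seg s : `|s| <= `|h * c| ->
    `|x - ((x + h *: v) + s *: w)| < r2.
  move=> sh; rewrite -addrA opprD addNKr normrN.
  apply: le_lt_trans (ler_normD _ _) _; rewrite !normrZ.
  rewrite ltr_pdivlMr // in hr2; apply: le_lt_trans hr2.
  rewrite /K !mulrDr mulr1 -addrA lerD2l -[leLHS]addr0 lerD // mulrA -normrM.
  by rewrite ler_wpM2r.
have [s sh E] : exists2 s : R, `|s| <= `|h * c| &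
    g ((x + h *: v) + (h * c) *: w) - g (x + h *: v) =
    (h * c) * 'D_w g ((x + h *: v) + s *: w).
  by apply: mvt_line_sym => s /near_seg /Hr2[].
have [_ H2] := Hr2 _ (near_seg s sh).
have -> : g (x + h *: (v + c *: w)) - g x - h * (D + c * 'D_w g x) =
   (g (x + h *: v) - g x - h * D) +
   h * c * ('D_w g (x + h *: v + s *: w) - 'D_w g x).
  by rewrite scalerDr scalerA addrA mulrBr -E; ring.
apply: le_trans (ler_normD _ _) _.
have -> : e * `|h| = e / 2 * `|h| + e / 2 * `|h| by field.
rewrite lerD // normrM distrC normrM -mulrA mulrC ler_wpM2r //.
apply: (@le_trans _ _ (`|c| * e')); first by rewrite ler_wpM2l.
rewrite /e' mulrA ler_pdivrMr // mulrC ler_pM2l ?divr_gt0 //.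
by rewrite lerDl.
Qed.

(** This stands in for the theorem that a function with continuous partial
    derivatives is differentiable. *)
Lemma is_derive_sumZ (I : Type) (s : seq I) (e : I -> V) (c : I -> R) g x :
  (forall i, \forall y \near x, derivable g y (e i)) ->
  (forall i, {for x, continuous ('D_(e i) g)}) ->
  is_derive x (\sum_(i <- s) c i *: e i) g (\sum_(i <- s) c i * 'D_(e i) g x).
Proof.
move=> dg cg; elim: s => [|i s IH]; first by rewrite !big_nil; exact: is_derive0.
by rewrite !big_cons [X in is_derive _ X]addrC [X in is_derive _ _ _ X]addrC;
   exact: is_derive_addZ.
Qed.

Lemma small_translate (A : set V) x v :
  nbhs x A -> exists2 r : R, 0 < r & forall s : R, `|s| < r -> A (x + s *: v).
Proof.
move=> nA.
have cA : (fun s : R => x + s *: v) @ (0 : R) --> x + 0 *: v.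
  by apply: cvgD; [exact: cvg_cst|apply: cvgZr_tmp; exact: cvg_id].
have : \forall s \near (0 : R), A (x + s *: v).
  by apply: cA; rewrite scale0r addr0.
move=> /nbhs_ballP[r /= r0 Hr]; exists r => // s sr; apply: Hr.
by rewrite -ball_normE /= sub0r normrN.
Qed.
End directional.

Section one_variable.
Variable R : realType.
Implicit Types phi psi : R -> R.

(** A one-sided parabola suffices, which serves maxima at an endpoint, such as
    the final time. *)
Lemma derive_le_of_upper_parabola phi (D b c r : R) : 0 < r ->
  is_derive (0 : R) (1 : R) phi D ->
  (forall s, 0 < s < r -> phi s <= phi 0 + b * s + c * s ^+ 2) -> D <= b.
Proof.
move=> r0 /is_derive_epsP dphi H; apply/ler_addgt0Pr => e e0.
have [r1 r10 Hr1] := dphi (e / 2) (divr_gt0 e0 (ltr0Sn _ 1)).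
pose k := e / 2 / (`|c| + 1).
have c1 : 0 < `|c| + 1 by rewrite ltr_wpDl.
have k0 : 0 < k by rewrite !divr_gt0.
pose s := Num.min (r / 2) (Num.min (r1 / 2) k).
have s0 : 0 < s by rewrite !lt_min !divr_gt0.
have sr : s < r by rewrite gt_min; apply/orP; left; lra.
have sr1 : s < r1 by rewrite !gt_min; apply/orP; right; apply/orP; left; lra.
have sk : s <= k by rewrite !ge_min lexx !orbT.
have := Hr1 s; rewrite (gtr0_norm s0) => /(_ sr1).
rewrite ler_norml => /andP[+ _]; rewrite add0r [_ *: 1]mulr1.
have := H s; rewrite s0 sr => /(_ isT) H1 H2.
have cs : c * s <= e / 2.
  apply: le_trans (ler_norm _) _; rewrite normrM (gtr0_norm s0).
  apply: (@le_trans _ _ (`|c| * k)); first by rewrite ler_wpM2l.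
  rewrite /k mulrA ler_pdivrMr // mulrC ler_pM2l ?divr_gt0 //.
  by rewrite lerDl.
rewrite -(ler_pM2l s0).
have : c * s * s <= e / 2 * s by rewrite ler_pM2r.
nra.
Qed.

(** First and second order conditions at an interior maximum of
    [phi s - b s - c s^2]: if [a > 2 c], the derivative of this difference is
    positive just after 0. *)
Lemma parabola_touch phi psi (a b c r : R) : 0 < r ->
  (forall s, `|s| < r -> is_derive s (1 : R) phi (psi s)) ->
  is_derive (0 : R) (1 : R) psi a ->
  (forall s, `|s| < r -> phi s <= phi 0 + b * s + c * s ^+ 2) ->
  psi 0 = b /\ a <= 2 * c.
Proof.
move=> r0 dphi dpsi H.
have d0 : is_derive (0 : R) (1 : R) phi (psi 0) by apply: dphi; rewrite normr0.
have E : psi 0 = b.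
  apply/eqP; rewrite eq_le; apply/andP; split.
    apply: (derive_le_of_upper_parabola r0 d0) => s /andP[s0 sr].
    by apply: H; rewrite gtr0_norm.
  rewrite -lerN2.
  have dN : is_derive (0 : R) (1 : R) (fun s => phi (- s)) (- psi 0).
    apply/is_derive_epsP => e /(proj1 (is_derive_epsP _ _ _ _) d0)[r1 r10 Hr1].
    exists r1 => // h hr1; have := Hr1 (- h); rewrite normrN => /(_ hr1).
    by rewrite !add0r oppr0 scaleNr mulNr mulrN.
  apply: (derive_le_of_upper_parabola (c := c) r0 dN) => s /andP[s0 sr].
  by rewrite oppr0; have := H (- s); rewrite normrN gtr0_norm // mulrN mulNr sqrrN; apply.
split => //; rewrite leNgt; apply/negP => ac.
have ac0 : 0 < a - 2 * c by rewrite subr_gt0.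
have [r1 r10 Hr1] := proj1 (is_derive_epsP _ _ _ _) dpsi _ (divr_gt0 ac0 (ltr0Sn _ 1)).
pose q := fun s : R => phi s - b * s - c * s ^+ 2.
have dq s : `|s| < r -> is_derive s (1 : R) q (psi s - b - 2 * c * s).
  move=> /dphi ds; rewrite /q.
  have -> : (fun s => phi s - b * s - c * s ^+ 2) =
    phi - (b \*: (@id R : R -> R)) - (c \*: (@id R ^+ 2 : R -> R)).
    by apply/funext => z /=; rewrite !fctE.
  apply: is_derive_eq; rewrite /GRing.scale /=; ring.
pose s := Num.min (r / 2) (r1 / 2).
have s0 : 0 < s by rewrite !lt_min !divr_gt0.
have sr : s < r by rewrite gt_min; apply/orP; left; lra.
have sr1 : s < r1 by rewrite !gt_min; apply/orP; right; lra.
have [t /andP[t0 ts]] : exists2 t : R, 0 < t < s & q s - q 0 = s * (psi t - b - 2 * c * t).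
  have [|t /andP[t0 ts]] := @mvt_line_in R R q 0 1 s s0.
    move=> t /andP[t0 ts]; rewrite add0r [_ *: 1]mulr1.
    by have [] : is_derive t (1 : R) q (psi t - b - 2 * c * t) by apply: dq; rewrite ger0_norm //; lra.
  rewrite !add0r ![_ *: 1]mulr1 => ->; exists t; first by rewrite t0.
  by rewrite (@derive_val _ _ _ _ _ _ _ (dq t _)) // ger0_norm ?ltW //; lra.
have := H s; rewrite gtr0_norm // => /(_ sr) Hs.
have := Hr1 t; rewrite gtr0_norm // => /(_ (lt_trans ts sr1)).
rewrite ler_norml => /andP[+ _]; rewrite add0r [_ *: 1]mulr1 E => Ht.
rewrite /q !mulr0 expr0n /= mulr0 !subr0 => Eq.
have : s * (psi t - b - 2 * c * t) <= 0 by rewrite -Eq; lra.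
rewrite pmulr_rle0 //; nra.
Qed.
End one_variable.

(** * Euclidean geometry and gradients along given directions *)

Section euclid.
Variables (R : realType) (n : nat).
Implicit Types p q v w : 'rV[R]_n.

Lemma dotvC p q : dotv p q = dotv q p.
Proof. by apply: eq_bigr => i _; rewrite mulrC. Qed.

Lemma dotvDl p q v : dotv (p + q) v = dotv p v + dotv q v.
Proof. by rewrite -big_split; apply: eq_bigr => i _; rewrite mxE mulrDl. Qed.

Lemma dotvZl (c : R) p v : dotv (c *: p) v = c * dotv p v.
Proof. by rewrite /dotv big_distrr; apply: eq_bigr => i _; rewrite mxE -mulrA. Qed.

Lemma dotvNl p v : dotv (- p) v = - dotv p v.
Proof. by rewrite -scaleN1r dotvZl mulN1r. Qed.

Lemma dotvBl p q v : dotv (p - q) v = dotv p v - dotv q v.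
Proof. by rewrite dotvDl dotvNl. Qed.

Lemma dotvDr p q v : dotv v (p + q) = dotv v p + dotv v q.
Proof. by rewrite !(dotvC v) dotvDl. Qed.

Lemma dotvZr (c : R) p v : dotv v (c *: p) = c * dotv v p.
Proof. by rewrite !(dotvC v) dotvZl. Qed.

Lemma dotvNr p v : dotv v (- p) = - dotv v p.
Proof. by rewrite !(dotvC v) dotvNl. Qed.

Lemma dotvBr p q v : dotv v (p - q) = dotv v p - dotv v q.
Proof. by rewrite !(dotvC v) dotvBl. Qed.

Definition dotvE := (dotvDl, dotvDr, dotvBl, dotvBr, dotvNl, dotvNr, dotvZl, dotvZr).

Lemma dotv_ge0 p : 0 <= dotv p p.
Proof. by apply: sumr_ge0 => i _; rewrite -expr2 sqr_ge0. Qed.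

Lemma dotv_eq0 p : dotv p p = 0 -> p = 0.
Proof.
move=> /eqP; rewrite psumr_eq0 => [/allP p0|i _]; last by rewrite -expr2 sqr_ge0.
apply/rowP => i; rewrite mxE; apply/eqP.
by have := p0 i (mem_index_enum _); rewrite /= -expr2 sqrf_eq0.
Qed.

Lemma enorm_ge0 p : 0 <= enorm p.
Proof. exact: sqrtr_ge0. Qed.

Lemma enorm_sqr p : enorm p ^+ 2 = dotv p p.
Proof. by rewrite sqr_sqrtr // dotv_ge0. Qed.

Lemma enormN p : enorm (- p) = enorm p.
Proof. by rewrite /enorm !dotvE opprK. Qed.

Lemma enormZ (c : R) p : enorm (c *: p) = `|c| * enorm p.
Proof.
by rewrite /enorm !dotvE mulrA -expr2 sqrtrM ?sqr_ge0 // sqrtr_sqr.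
Qed.

Lemma enorm_gt0 p : (0 < enorm p) = (p != 0).
Proof.
rewrite lt_neqAle enorm_ge0 andbT eq_sym; congr (~~ _); apply/eqP/eqP => [p0|->].
  by apply: dotv_eq0; rewrite -enorm_sqr p0 expr0n.
by rewrite -[0 : 'rV_n](scale0r 0) enormZ normr0 mul0r.
Qed.

Lemma dotv_le_enorm p q : dotv p q <= enorm p * enorm q.
Proof.
apply: le_trans (ler_norm _) _.
rewrite -(@ler_pXn2r _ 2) ?nnegrE ?mulr_ge0 ?enorm_ge0 // exprMn !enorm_sqr.
rewrite -normrX ger0_norm ?sqr_ge0 //.
have [/dotv_eq0 ->|q0] := eqVneq (dotv q q) 0.
  by rewrite -[0 : 'rV_n](scale0r 0) !dotvE !mul0r expr0n mulr0.
have qgt : 0 < dotv q q by rewrite lt_neqAle eq_sym q0 dotv_ge0.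
rewrite -subr_ge0 -(pmulr_rge0 _ qgt).
have := dotv_ge0 (dotv q q *: p - dotv p q *: q).
rewrite !dotvE (dotvC q p); congr (_ <= _); ring.
Qed.

Lemma enormD p q :
  enorm (p + q) <= enorm p + enorm q.
Proof.
rewrite -(@ler_pXn2r _ 2) ?nnegrE ?addr_ge0 ?enorm_ge0 // sqrrD !enorm_sqr !dotvE.
have := dotv_le_enorm p q; rewrite (dotvC q p); lra.
Qed.

Lemma dotv_basis p i : dotv p (basis_vec R i) = p 0 i.
Proof.
rewrite /dotv (bigD1 i) //= big1 => [|j ji]; rewrite /basis_vec mxE eqxx /=.
  by rewrite eqxx mulr1 addr0.
by rewrite (negbTE ji) mulr0.
Qed.

Lemma normr_coord_le p i : `|p 0 i| <= enorm p.
Proof.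
have E1 : enorm (basis_vec R i) = 1.
  by rewrite /enorm dotv_basis /basis_vec mxE !eqxx sqrtr1.
have := dotv_le_enorm p (basis_vec R i).
have := dotv_le_enorm (- p) (basis_vec R i).
rewrite enormN !dotvE !dotv_basis E1 mulr1 => ? ?; rewrite ler_norml.
by apply/andP; split; lra.
Qed.

Lemma row_sum_basis p : \sum_i p 0 i *: basis_vec R i = p.
Proof. by rewrite [RHS]row_sum_delta. Qed.

Lemma row_sum_dir_x p : \sum_i p 0 i *: dir_x R i = (p, 0).
Proof.
have -> : \sum_i p 0 i *: dir_x R i = (\sum_i p 0 i *: basis_vec R i, 0).
  elim/big_rec2: _ => // i y1 y2 _ ->; rewrite /dir_x.
  by congr (_, _); rewrite /= scaler0 add0r.
by rewrite row_sum_basis.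
Qed.
End euclid.

Section C1_along.
Variables (R : realType) (V : normedModType R) (n : nat) (e : 'I_n -> V).
Implicit Types (g : V -> R) (z : V) (v : 'rV[R]_n).

Definition combine v : V := \sum_i v 0 i *: e i.

Definition grad_along g z : 'rV[R]_n := \row_i 'D_(e i) g z.

(** With [V = R^n] and the basis vectors this describes functions of [x]; with
    [V = R^n x R] and the spatial basis vectors, functions of [(x, t)] that are
    continuously differentiable in [x]. *)
Definition C1_along (A : set V) g := forall z, A z -> forall i,
  derivable g z (e i) /\ {for z, continuous ('D_(e i) g)}.

Lemma combineZ (c : R) v : combine (c *: v) = c *: combine v.
Proof.
by rewrite /combine scaler_sumr; apply: eq_bigr => i _; rewrite mxE scalerA.
Qed.

Lemma is_derive_combine (A : set V) g z v : open A -> C1_along A g -> A z ->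
  is_derive z (combine v) g (dotv (grad_along g z) v).
Proof.
move=> oA gA Az.
have -> : dotv (grad_along g z) v = \sum_i v 0 i * 'D_(e i) g z.
  by apply: eq_bigr => i _; rewrite mxE mulrC.
apply: is_derive_sumZ => i; last exact: (gA _ Az i).2.
by apply: filterS (open_nbhs_nbhs (conj oA Az)) => y /gA /(_ i)[].
Qed.

Lemma grad_bound_lipschitz (A : set V) g (M : R) z v : open A -> C1_along A g ->
  (forall y, A y -> enorm (grad_along g y) <= M) ->
  (forall s : R, 0 <= s <= 1 -> A (z + s *: combine v)) ->
  g (z + combine v) - g z <= M * enorm v.
Proof.
move=> oA gA gM zv.
have [|s /andP[s0 s1]] := @mvt_line_in R V g z (combine v) 1 ltr01.
  by move=> s /zv /(is_derive_combine v oA gA)[].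
rewrite scale1r mul1r => ->.
have As : A (z + s *: combine v) by apply: zv; rewrite !ltW.
rewrite (@derive_val _ _ _ _ _ _ _ (is_derive_combine v oA gA As)).
apply: le_trans (dotv_le_enorm _ _) _; rewrite ler_wpM2r ?enorm_ge0 //.
exact: gM.
Qed.

(** The Lipschitz bound is tested in the direction of the gradient itself. *)
Lemma lipschitz_grad_bound (A : set V) g (M : R) z : open A -> C1_along A g ->
  A z -> 0 <= M ->
  (forall v (s : R), A (z + s *: combine v) ->
     g (z + s *: combine v) - g z <= M * enorm (s *: v)) ->
  enorm (grad_along g z) <= M.
Proof.
move=> oA gA Az M0 gM; set p := grad_along g z.
have [p0|p0] := eqVneq p 0.
  by rewrite p0 -[0 : 'rV_n](scale0r 0) enormZ normr0 mul0r.
have pgt : 0 < enorm p by rewrite enorm_gt0.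
rewrite -(ler_pM2r pgt) -expr2 enorm_sqr.
have [r r0 Hr] := small_translate (combine p) (open_nbhs_nbhs (conj oA Az)).
have d1 : is_derive (0 : R) (1 : R) (fun s : R => g (z + s *: combine p)) (dotv p p).
  by apply: is_derive_line; rewrite scale0r addr0; exact: is_derive_combine Az.
apply: (derive_le_of_upper_parabola (c := 0) r0 d1) => s /andP[s0 sr].
have As : A (z + s *: combine p) by apply: Hr; rewrite gtr0_norm.
have := gM p s As; rewrite enormZ gtr0_norm // scale0r addr0 mul0r addr0; lra.
Qed.
End C1_along.

(** * Derivatives extended to the closure *)

Section extension.
Variables (R : realType) (V : normedModType R).
Implicit Types (g : V -> R) (A B : set V) (x v : V).

(** A full neighbourhood filter contains the point, so the limit can only be the
    value there. *)
Lemma cvg_nbhs_value g x : cvg (g @ nbhs x) -> {for x, continuous g}.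
Proof.
move=> /cvg_ex[l gl]; suff E : g x = l by move: gl; rewrite -E.
apply/eqP; rewrite -subr_eq0 -normr_le0; apply/ler_addgt0Pr => e e0.
rewrite add0r distrC; move: gl => /cvgrPdist_le /(_ _ e0).
exact: nbhs_singleton.
Qed.

Lemma extends_continuous_at A B g x : open A -> A `<=` B ->
  extends_continuously A B g -> A x -> {for x, continuous g}.
Proof.
move=> oA AB gAB Ax; have := gAB x (AB _ Ax).
rewrite (_ : within A (nbhs x) = nbhs x); first exact: cvg_nbhs_value.
exact/within_interior/open_nbhs_nbhs.
Qed.

Lemma DbarE A B v g x : open A -> A `<=` B ->
  extends_continuously A B ('D_v g) -> A x -> Dbar A v g x = 'D_v g x.
Proof.
move=> oA AB gAB Ax; rewrite /Dbar.
rewrite (_ : within A (nbhs x) = nbhs x); last exact/within_interior/open_nbhs_nbhs.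
exact: (cvg_lim (@Rhausdorff R) (extends_continuous_at oA AB gAB Ax)).
Qed.

Lemma Dbar_cvg A B v g x : extends_continuously A B ('D_v g) -> B x ->
  ('D_v g) @ within A (nbhs x) --> Dbar A v g x.
Proof. by move=> gAB /gAB. Qed.

Lemma extends_continuously_bounded A B g : compact B -> A `<=` B ->
  extends_continuously A B g ->
  exists M : R, forall x, A x -> `|g x| <= M.
Proof.
move=> cB AB gAB.
have := proj1 (compact_near_coveringP B) cB R (+oo)%R
  (fun M x => A x -> `|g x| <= M) _.
have H x : B x -> \forall x' \near x & M \near +oo%R, A x' -> `|g x'| <= M.
  move=> Bx; have /cvg_ex[l gl] := gAB x Bx.
  have : \forall y \near within A (nbhs x), `|g y| <= `|l| + 1.
    move: gl => /cvgrPdist_le /(_ _ ltr01); apply: filterS => y ly.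
    by rewrite -lerBlDl (le_trans (lerB_dist _ _)) // distrC.
  move=> gl1; exists ([set y | A y -> `|g y| <= `|l| + 1], [set M | `|l| + 1 <= M]).
    by split => //=; apply: nbhs_pinfty_ge; rewrite num_real.
  by move=> [y M] [/= yl lM] /yl /le_trans; exact.
move=> /(_ _ H) HM.
have [M [_ HMM]] := HM; exists (M + 1) => x Ax.
by apply: (HMM (M + 1)) => //; [rewrite ltrDl|exact: AB].
Qed.

End extension.

Section slice.
Variables (R : realType) (n : nat).

Lemma is_derive_dir_x (u : 'rV[R]_n * R -> R) (x : 'rV[R]_n) t v D :
  is_derive (x, t) (v, 0 : R) u D -> is_derive x v (fun y => u (y, t)) D.
Proof.
move=> /is_derive_epsP H; apply/is_derive_epsP => e /H[r r0 Hr].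
exists r => // h /Hr; congr (_ <= _); congr (`|u _ - _ - _|).
by congr (_, _); rewrite /= scaler0 addr0.
Qed.

End slice.

(** * Convex domains and their outer normals *)

Section convex_sets.
Variables (R : realType) (n : nat) (Omega : set 'rV[R]_n).
Hypothesis convO : @convex_set R 'rV[R]_n Omega.

Lemma convex_segment x y (s : R) : Omega x -> Omega y -> 0 <= s <= 1 ->
  Omega (x + s *: (y - x)).
Proof.
move=> Ox Oy /andP[s0 s1].
have := convO (Itv01 s0 s1) (mem_set Oy) (mem_set Ox).
have -> : x + s *: (y - x) = s *: y + (1 - s) *: x.
  by apply/rowP => i; rewrite !mxE; ring.
by rewrite inE.
Qed.

(** The tangent half-space inequality below is wanted at all points of the
    closure, the second point of the pair being possibly on the boundary too. *)
Lemma convex_closure_segment x y (s : R) :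
  closure Omega x -> closure Omega y -> 0 <= s <= 1 ->
  closure Omega (x + s *: (y - x)).
Proof.
move=> cx cy s01 B /nbhs_ballP[r /= r0 rB].
have [x' [Ox' xx']] := cx _ (nbhsx_ballx x r r0).
have [y' [Oy' yy']] := cy _ (nbhsx_ballx y r r0).
exists (x' + s *: (y' - x')); split; first exact: convex_segment.
apply: rB; move: xx' yy'; rewrite -!ball_normE /= => xx' yy'.
have -> : x + s *: (y - x) - (x' + s *: (y' - x')) =
    (1 - s) *: (x - x') + s *: (y - y').
  by apply/rowP => i; rewrite !mxE; ring.
apply: le_lt_trans (ler_normD _ _) _; rewrite !normrZ.
move: s01 => /andP[s0 s1]; rewrite (ger0_norm s0) ger0_norm ?subr_ge0 //.
have [->|s00] := eqVneq s 0; first by rewrite subr0 mul1r mul0r addr0.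
have sgt : 0 < s by rewrite lt_neqAle eq_sym s00.
have : s * `|y - y'| < s * r by rewrite ltr_pM2l.
have : (1 - s) * `|x - x'| <= (1 - s) * r by rewrite ler_wpM2l ?subr_ge0 // ltW.
lra.
Qed.
End convex_sets.

Section normals.
Variables (R : realType) (n : nat) (Omega : set 'rV[R]_n).
Hypothesis convO : @convex_set R 'rV[R]_n Omega.
Hypothesis openO : open Omega.

Lemma C_open_C1_along (U : set 'rV[R]_n) (k : nat) rho : open U -> (0 < k)%N ->
  C_open U k rho -> C1_along (@basis_vec R n) U rho.
Proof.
move=> oU k0 Cr z Uz i.
have [/= [_ dr] cr] := Cr [:: i] k0.
by split; [exact: dr|exact: (extends_continuous_at oU _ cr Uz)].
Qed.

(** If [grad rho x] made an acute angle with [z - x], then [rho] would be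
    positive at some point of the segment from [x] to [z], hence near that
    point; yet the segment lies in the closure of [Omega], where [rho <= 0]. *)
Lemma grad_sign (x z : 'rV[R]_n) U rho : frontier Omega x ->
  C2_defining_function Omega x U rho -> closure Omega z ->
  dotv (grad rho x) (z - x) <= 0.
Proof.
move=> [clx nix] [[oU Ux] Cr _ Or] clz.
have C1 := C_open_C1_along oU (ltn0Sn 1) Cr.
have cont_rho y : U y -> {for y, continuous rho}.
  by move=> Uy; have [_ cr] := Cr [::] isT; exact: (extends_continuous_at oU _ cr Uy).
have out y : U y -> 0 < rho y -> ~ closure Omega y.
  move=> Uy ry /(_ (U `&` [set w | 0 < rho w])) []; last first.
    by move=> w [Ow [Uw /= rw]]; move: Ow; rewrite Or // ltNge ltW.
  apply: filterI; first exact: open_nbhs_nbhs.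
  by have /cvgr_gt := cont_rho y Uy; apply.
rewrite leNgt; apply/negP => D0.
have /is_derive_epsP/(_ _ (divr_gt0 D0 (ltr0Sn _ 1)))[r r0 Hr] :
    is_derive x (z - x) rho (dotv (grad rho x) (z - x)).
  by have := is_derive_combine (z - x) oU C1 Ux; rewrite /combine row_sum_basis.
have [r1 r10 Hr1] := small_translate (z - x) (open_nbhs_nbhs (conj oU Ux)).
pose s := Num.min (1 / 2) (Num.min (r / 2) (r1 / 2)).
have s0 : 0 < s by rewrite !lt_min !divr_gt0.
have s1 : s <= 1 by rewrite ge_min; apply/orP; left; lra.
have sr : `|s| < r by rewrite gtr0_norm // !gt_min; apply/orP; right; apply/orP; left; lra.
have sr1 : `|s| < r1 by rewrite gtr0_norm // !gt_min; apply/orP; right; apply/orP; right; lra.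
have rx : 0 <= rho x.
  rewrite leNgt; apply/negP => /(Or _ Ux) Ox; apply: nix.
  exact: open_nbhs_nbhs.
apply: (out (x + s *: (z - x))).
- exact: Hr1.
- have := Hr s sr; rewrite (gtr0_norm s0) ler_norml => /andP[+ _].
  have := mulr_gt0 s0 D0; lra.
- by apply: convex_closure_segment => //; rewrite ltW.
Qed.

(** The inequality is strict because [z] may be pushed a little further along
    [grad rho x] without leaving [Omega]. *)
Lemma grad_sign_lt (x z : 'rV[R]_n) U rho : frontier Omega x ->
  C2_defining_function Omega x U rho -> Omega z ->
  dotv (grad rho x) (z - x) < 0.
Proof.
move=> fx Crho Oz.
have [r r0 Hr] := small_translate (grad rho x) (open_nbhs_nbhs (conj openO Oz)).
have r2 : `|r / 2| < r by rewrite gtr0_norm ?divr_gt0 //; lra.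
have := grad_sign fx Crho (subset_closure (Hr _ r2)).
have [[_ Ux] _ + _] := Crho => /(_ _ Ux); rewrite -enorm_gt0 => g0.
rewrite (addrAC z) (dotvDr (z - x)) dotvZr -enorm_sqr.
have : 0 < r / 2 * enorm (grad rho x) ^+ 2 by rewrite mulr_gt0 ?exprn_gt0 ?divr_gt0.
lra.
Qed.

Lemma inward_segment (x v : 'rV[R]_n) U rho : frontier Omega x ->
  C2_defining_function Omega x U rho -> dotv (grad rho x) v < 0 ->
  exists2 r : R, 0 < r & forall s, 0 < s < r -> Omega (x + s *: v).
Proof.
move=> [clx nix] [[oU Ux] Cr _ Or] D0.
have C1 := C_open_C1_along oU (ltn0Sn 1) Cr.
have D0' : 0 < - dotv (grad rho x) v / 2 by rewrite divr_gt0 // oppr_gt0.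
have /is_derive_epsP/(_ _ D0')[r r0 Hr] : is_derive x v rho (dotv (grad rho x) v).
  by have := is_derive_combine v oU C1 Ux; rewrite /combine row_sum_basis.
have [r1 r10 Hr1] := small_translate v (open_nbhs_nbhs (conj oU Ux)).
have cont_rho : {for x, continuous rho}.
  by have [_ cr] := Cr [::] isT; exact: (extends_continuous_at oU _ cr Ux).
have rx : rho x <= 0.
  rewrite leNgt; apply/negP => rx.
  have [w [Ow [Uw /= rw]]] : (Omega `&` (U `&` [set w | 0 < rho w])) !=set0.
    apply: clx; apply: filterI; first exact: open_nbhs_nbhs.
    by have /cvgr_gt := cont_rho; apply.
  by move: Ow; rewrite Or // ltNge ltW.
exists (Num.min r r1); first by rewrite lt_min r0.
move=> s /andP[s0]; rewrite lt_min => /andP[sr sr1].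
apply/Or; first by apply: Hr1; rewrite gtr0_norm.
have := Hr s; rewrite (gtr0_norm s0) => /(_ sr); rewrite ler_norml => /andP[_].
have : s * dotv (grad rho x) v < 0 by rewrite pmulr_rlt0.
lra.
Qed.

Variable nu : 'rV[R]_n -> 'rV[R]_n.
Hypothesis nuO : outer_unit_normal Omega nu.

Lemma outer_normal_convex (x : 'rV[R]_n) : frontier Omega x ->
  [/\ forall z, closure Omega z -> 0 <= dotv (x - z) (nu x),
      forall z, Omega z -> 0 < dotv (x - z) (nu x) &
      exists2 r : R, 0 < r & forall s, 0 < s < r -> Omega (x + s *: - nu x)].
Proof.
move=> fx; have [U [rho [Crho nuE]]] := nuO fx.
have [[_ Ux] _ + _] := Crho => /(_ _ Ux); rewrite -enorm_gt0 => g0.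
have E z : dotv (x - z) (nu x) = - ((enorm (grad rho x))^-1 * dotv (grad rho x) (z - x)).
  by rewrite nuE dotvC dotvZl -mulrN -dotvNr opprB.
split.
- by move=> z clz; rewrite E oppr_ge0 pmulr_rle0 ?invr_gt0 //; exact: (grad_sign fx Crho clz).
- by move=> z Oz; rewrite E oppr_gt0 pmulr_rlt0 ?invr_gt0 //; exact: (grad_sign_lt fx Crho Oz).
apply: (inward_segment fx Crho).
by rewrite nuE dotvNr dotvZr -enorm_sqr oppr_lt0 mulr_gt0 ?invr_gt0 ?exprn_gt0.
Qed.
End normals.

(** * Degenerate ellipticity *)

Section ellipticity.
Variables (R : realType) (n : nat).
Implicit Types (N M A B : 'M[R]_n) (p v w : 'rV[R]_n).

Definition bil N v w : R := dotv v (w *m N).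

Lemma bil_sum_basis N p w : \sum_k p 0 k * bil N (basis_vec R k) w = bil N p w.
Proof. by apply: eq_bigr => k _; rewrite /bil dotvC dotv_basis. Qed.

Lemma bil_sum_basisr N p w : \sum_k p 0 k * bil N w (basis_vec R k) = bil N w p.
Proof.
have E : dotv w (\sum_k p 0 k *: (basis_vec R k *m N)) =
    \sum_k dotv w (p 0 k *: (basis_vec R k *m N)).
  rewrite /dotv exchange_big /=; apply: eq_bigr => i _.
  by rewrite summxE big_distrr.
rewrite /bil -[in RHS](row_sum_basis p) mulmx_suml.
under [in RHS]eq_bigr do rewrite -scalemxAl.
by rewrite E; apply: eq_bigr => k _; rewrite dotvZr.
Qed.

Lemma bil_basis N k : bil N (basis_vec R k) (basis_vec R k) = N k k.
Proof. by rewrite /bil dotvC dotv_basis /basis_vec -rowE mxE. Qed.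

(** The vectors [|p|^2 e_k - p_k p] are, up to scale, the projections of the basis
    onto the orthogonal complement of [p], and the values of the form on them
    add up to [|p|^2 (|p|^2 tr N - N(p, p))]. This replaces the choice of an
    orthonormal basis adapted to [p]. *)
Lemma trace_le_bil N p : (forall v, bil N v v <= 0) -> p != 0 ->
  dotv p p * \tr N <= bil N p p.
Proof.
move=> N0; rewrite -enorm_gt0 => p0.
have a0 : 0 < dotv p p by rewrite -enorm_sqr exprn_gt0.
set a := dotv p p in a0 *.
have : \sum_k bil N (a *: basis_vec R k - p 0 k *: p)
                    (a *: basis_vec R k - p 0 k *: p) <= 0.
  by apply: sumr_le0 => k _.
have E k : bil N (a *: basis_vec R k - p 0 k *: p) (a *: basis_vec R k - p 0 k *: p)
   = a ^+ 2 * N k k - a * (p 0 k * bil N (basis_vec R k) p)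
     - a * (p 0 k * bil N p (basis_vec R k)) + p 0 k * p 0 k * bil N p p.
  rewrite -(bil_basis N k) /bil mulmxBl -!scalemxAl !dotvE; ring.
under eq_bigr do rewrite E.
rewrite big_split /= !sumrB -!big_distrr -big_distrl /= bil_sum_basis bil_sum_basisr.
rewrite -/(mxtrace N) -/(dotv p p) -/a => H.
rewrite -subr_le0 -(pmulr_rle0 _ a0); apply: le_trans H.
by rewrite le_eqVlt; apply/orP; left; apply/eqP; ring.
Qed.

Definition coef (f0 f1 : R -> R) p (i j : 'I_n) : R :=
  f0 (dotv p p) * (i == j)%:R + 2 * f1 (dotv p p) * (p 0 i * p 0 j).

(** With [f0 = f] and [f1 = f'] the matrix [coef] is the derivative of
    [sigma] at [p], so that this is div (sigma (Du)) written in
    nondivergence form, [p] being the gradient and [A] the Hessian. *)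
Definition ell_op (f0 f1 : R -> R) p A : R :=
  \sum_i \sum_j coef f0 f1 p i j * A i j.

Lemma ell_opE f0 f1 p A : ell_op f0 f1 p A =
  f0 (dotv p p) * \tr A + 2 * f1 (dotv p p) * bil A p p.
Proof.
rewrite /ell_op /coef /mxtrace big_distrr /= /bil.
have -> : dotv p (p *m A) = \sum_i \sum_j p 0 i * p 0 j * A i j.
  rewrite exchange_big; apply: eq_bigr => j _; rewrite mxE big_distrr /=.
  by apply: eq_bigr => i _; ring.
rewrite big_distrr -big_split; apply: eq_bigr => i _ /=.
rewrite big_distrr (bigD1 i) //= [in RHS](bigD1 i) //= eqxx addrA; congr (_ + _).
  by rewrite mulr1; ring.
by apply: eq_bigr => j ji; rewrite eq_sym (negbTE ji) mulr0 add0r; ring.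
Qed.

Lemma ell_opB f0 f1 p A B :
  ell_op f0 f1 p (A - B) = ell_op f0 f1 p A - ell_op f0 f1 p B.
Proof.
rewrite /ell_op -sumrB; apply: eq_bigr => i _; rewrite -sumrB.
by apply: eq_bigr => j _; rewrite !mxE mulrBr.
Qed.

(** The eigenvalues of [coef] are [f0] across [p] and [f0 + 2 |p|^2 f1] along
    [p]; both are nonnegative. The two directions are separated by
    [trace_le_bil]. *)
Lemma ell_op_le f0 f1 p M (d : R) : p != 0 ->
  0 <= f0 (dotv p p) ->
  0 <= f0 (dotv p p) + 2 * dotv p p * f1 (dotv p p) ->
  (forall v, bil M v v <= d * dotv v v) ->
  ell_op f0 f1 p M <=
    d * (n%:R * f0 (dotv p p) + 2 * dotv p p * f1 (dotv p p)).
Proof.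
move=> p0; set a := dotv p p; move=> h0 h1 HM.
have a0 : 0 < a by rewrite /a -enorm_sqr exprn_gt0 // enorm_gt0.
pose N := M - d%:M.
have bilN v : bil N v v = bil M v v - d * dotv v v.
  by rewrite /bil /N mulmxBr mul_mx_scalar !dotvE.
have N0 v : bil N v v <= 0 by rewrite bilN subr_le0.
have := trace_le_bil N0 p0; rewrite -/a => tN.
have trN : \tr N = \tr M - n%:R * d.
  by rewrite /N raddfB /= mxtrace_scalar mulr_natl.
have bp : bil N p p <= 0 by [].
rewrite ell_opE -/a.
have -> : \tr M = \tr N + n%:R * d by rewrite trN subrK.
have -> : bil M p p = bil N p p + d * a by rewrite bilN subrK.
have H : a * (f0 a * \tr N) <= f0 a * bil N p p by rewrite mulrCA ler_wpM2l.
have H2 : (f0 a + 2 * a * f1 a) * bil N p p <= 0 by rewrite mulr_ge0_le0.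
suff : f0 a * \tr N + 2 * f1 a * bil N p p <= 0 by lra.
rewrite -(pmulr_rle0 _ a0).
have -> : a * (f0 a * \tr N + 2 * f1 a * bil N p p) =
  a * (f0 a * \tr N) - f0 a * bil N p p + (f0 a + 2 * a * f1 a) * bil N p p by ring.
lra.
Qed.

Lemma ell_op_close f0 f1 p w A (K eta : R) :
  (forall i j, `|A i j| <= K) ->
  (forall i j, `|coef f0 f1 p i j - coef f0 f1 w i j| <= eta) -> 
  `|ell_op f0 f1 p A - ell_op f0 f1 w A| <= n%:R ^+ 2 * (eta * K).
Proof.
move=> AK ceta; rewrite /ell_op -sumrB.
apply: le_trans (ler_norm_sum _ _ _) _.
have -> : n%:R ^+ 2 * (eta * K) = \sum_(i < n) \sum_(j < n) eta * K.
  rewrite sumr_const card_ord sumr_const card_ord -mulrnA -[RHS]mulr_natl natrM.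
  by rewrite expr2.
apply: ler_sum => i _; rewrite -sumrB.
apply: le_trans (ler_norm_sum _ _ _) _; apply: ler_sum => j _.
by rewrite -mulrBl normrM ler_pM.
Qed.

(** Uniformity over the sphere [|w| = L] matters: the vector [w] to which this
    is applied depends on the penalization parameter, hence on [r]. *)
Lemma coef_close (f0 f1 : R -> R) (L eta : R) : 0 < L -> 0 < eta ->
  {for L ^+ 2, continuous f0} -> {for L ^+ 2, continuous f1} ->
  exists2 r : R, 0 < r & forall p w, enorm w = L ->
    (forall i, `|p 0 i - w 0 i| <= r) ->
    forall i j, `|coef f0 f1 p i j - coef f0 f1 w i j| <= eta.
Proof.
move=> L0 eta0 c0 c1.
pose b := `|f1 (L ^+ 2)|.
pose k := eta / 2 / (2 + 2 * (L + 1) ^+ 2).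
have den : 0 < 2 + 2 * (L + 1) ^+ 2 :> R.
  by rewrite ltr_pwDl // mulr_ge0 // sqr_ge0.
have k0 : 0 < k by rewrite !divr_gt0.
have [r1 r10 Hr1] : exists2 r : R, 0 < r & forall s, `|L ^+ 2 - s| < r ->
    `|f0 (L ^+ 2) - f0 s| <= k /\ `|f1 (L ^+ 2) - f1 s| <= k.
  have H : nbhs (L ^+ 2) (fun s => `|f0 (L ^+ 2) - f0 s| <= k /\ `|f1 (L ^+ 2) - f1 s| <= k).
    apply: filterI; first by move: c0 => /cvgrPdist_le/(_ _ k0).
    by move: c1 => /cvgrPdist_le/(_ _ k0).
  move: H => /nbhs_ballP[r /= r0 Hr]; exists r => // s sr; exact: Hr.
pose m := 2 * L + 1.
have m0 : 0 < m by rewrite addr_gt0 // mulr_gt0.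
pose r := Num.min 1 (Num.min (r1 / 2 / (m * n.+1%:R)) (eta / 4 / ((b + 1) * m))).
have b0 : 0 < b + 1 by rewrite ltr_wpDl // normr_ge0.
have rgt : 0 < r by rewrite !lt_min ltr01 !divr_gt0 // mulr_gt0.
have r_1 : r <= 1 by rewrite ge_min lexx.
have r_2 : r * (m * n.+1%:R) <= r1 / 2.
  by rewrite -ler_pdivlMr ?mulr_gt0 // !ge_min lexx orbT.
have r_3 : r * ((b + 1) * m) <= eta / 4.
  by rewrite -ler_pdivlMr ?mulr_gt0 // !ge_min lexx !orbT.
exists r => // p w wL pw.
have wi i : `|w 0 i| <= L by rewrite -wL normr_coord_le.
have pp i j : `|p 0 i * p 0 j - w 0 i * w 0 j| <= r * m.
  have -> : p 0 i * p 0 j - w 0 i * w 0 j =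
    (p 0 i - w 0 i) * (p 0 j - w 0 j) + (p 0 i - w 0 i) * w 0 j
     + w 0 i * (p 0 j - w 0 j) by ring.
  have H1 : `|(p 0 i - w 0 i) * (p 0 j - w 0 j)| <= r * 1.
    by rewrite normrM ler_pM // (le_trans (pw j)).
  have H2 : `|(p 0 i - w 0 i) * w 0 j| <= r * L by rewrite normrM ler_pM.
  have H3 : `|w 0 i * (p 0 j - w 0 j)| <= r * L by rewrite mulrC normrM ler_pM.
  apply: le_trans (ler_normD _ _) _; apply: le_trans (lerD (ler_normD _ _) (lexx _)) _.
  rewrite /m; lra.
have sq : `|L ^+ 2 - dotv p p| < r1.
  rewrite -wL enorm_sqr distrC /dotv -sumrB.
  apply: (@le_lt_trans _ _ (r1 / 2)); last lra.
  apply: le_trans r_2; apply: le_trans (ler_norm_sum _ _ _) _.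
  apply: (@le_trans _ _ (\sum_(i < n) r * m)); first by apply: ler_sum => i _.
  rewrite sumr_const card_ord -[_ *+ n]mulr_natr -mulrA ler_pM2l // ler_pM2l //.
  by rewrite ler_nat.
have [H0 H1] := Hr1 _ sq; move=> i j.
have ww : dotv w w = L ^+ 2 by rewrite -wL enorm_sqr.
rewrite /coef ww; set s := dotv p p in H0 H1 *; set S := L ^+ 2 in H0 H1 *.
have pij : `|p 0 i * p 0 j| <= (L + 1) ^+ 2.
  rewrite normrM expr2; apply: ler_pM => //.
    by rewrite -(subrK (w 0 i) (p 0 i)) (le_trans (ler_normD _ _)) // addrC lerD // (le_trans (pw i)).
  by rewrite -(subrK (w 0 j) (p 0 j)) (le_trans (ler_normD _ _)) // addrC lerD // (le_trans (pw j)).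
have -> : f0 s * (i == j)%:R + 2 * f1 s * (p 0 i * p 0 j) -
   (f0 S * (i == j)%:R + 2 * f1 S * (w 0 i * w 0 j)) =
   (f0 s - f0 S) * (i == j)%:R + 2 * ((f1 s - f1 S) * (p 0 i * p 0 j))
   + 2 * (f1 S * (p 0 i * p 0 j - w 0 i * w 0 j)) by ring.
rewrite [`|f0 S - _|]distrC in H0; rewrite [`|f1 S - _|]distrC in H1.
have T0 : `|(f0 s - f0 S) * (i == j)%:R| <= k.
  by case: eqP => _; rewrite ?mulr1 // mulr0 normr0 ltW.
have T1 : `|2 * ((f1 s - f1 S) * (p 0 i * p 0 j))| <= 2 * (k * (L + 1) ^+ 2).
  by rewrite normrM ger0_norm // ler_wpM2l // normrM ler_pM.
have T2 : `|2 * (f1 S * (p 0 i * p 0 j - w 0 i * w 0 j))| <= eta / 2.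
  rewrite normrM ger0_norm // normrM.
  have : `|f1 S| * `|p 0 i * p 0 j - w 0 i * w 0 j| <= (b + 1) * (r * m).
    by rewrite ler_pM // /b lerDl.
  lra.
apply: le_trans (ler_normD _ _) _; apply: le_trans (lerD (ler_normD _ _) (lexx _)) _.
have : k * (2 + 2 * (L + 1) ^+ 2) = eta / 2 by rewrite /k divfK // gt_eqF.
lra.
Qed.
End ellipticity.

(** * The law sigma, its divergence, and second derivatives *)

Section chain.
Variables (R : realType) (V : normedModType R).

Lemma is_derive_of_line (g : V -> R) a v (D : R) :
  is_derive (0 : R) (1 : R) (fun r : R => g (a + r *: v)) D -> is_derive a v g D.
Proof.
move=> /is_derive_epsP H; apply/is_derive_epsP => e /H[r r0 Hr].
exists r => // h /Hr.
by rewrite add0r [_ *: 1]mulr1 scale0r addr0.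
Qed.

Lemma is_derive_comp1 (f : R -> R) (g : V -> R) x v (df dg : R) :
  is_derive (g x) (1 : R) f df -> is_derive x v g dg ->
  is_derive x v (fun y => f (g y)) (df * dg).
Proof.
move=> Df Dg; apply: is_derive_of_line.
have Dl : is_derive (0 : R) (1 : R) (fun r : R => g (x + r *: v)) dg.
  by apply: is_derive_line; rewrite scale0r addr0.
have Df' : is_derive ((fun r : R => g (x + r *: v)) 0) (1 : R) f df.
  by rewrite scale0r addr0.
have := @is_derive1_comp R f (fun r : R => g (x + r *: v)) 0 df dg Df' Dl.
by [].
Qed.

Lemma is_derive_sum_fun (I : Type) (s : seq I) (h : I -> V -> R) x v (dh : I -> R) :
  (forall i, is_derive x v (h i) (dh i)) ->
  is_derive x v (fun y => \sum_(i <- s) h i y) (\sum_(i <- s) dh i).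
Proof.
move=> H; elim: s => [|i s IH].
  rewrite big_nil (_ : (fun y => _) = cst 0); first exact: is_derive_cst.
  by apply/funext => y; rewrite big_nil.
rewrite big_cons (_ : (fun y => _) = h i + (fun y => \sum_(i <- s) h i y)).
  exact: is_deriveD.
by apply/funext => y; rewrite big_cons.
Qed.
End chain.

Section scalar_law.
Variables (R : realType) (f : R -> R).
Hypothesis Cf : C_nonneg 1 f.

Let open_pos : open (@pos_reals R).
Proof. exact: interval_open. Qed.

Let posP s : @pos_reals R s <-> 0 < s.
Proof. by rewrite /pos_reals /= in_itv /= andbT. Qed.

Lemma C1_derivable s : 0 < s -> derivable f s 1.
Proof. by move=> /posP s0; have [[_ +] _] := Cf.2 1 isT; exact. Qed.

Lemma C1_continuous s : 0 < s -> {for s, continuous f}.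
Proof.
move=> /posP s0; have [_ c] := Cf.2 0 isT.
exact: (extends_continuous_at open_pos (@subset_closure _ _) c s0).
Qed.

Lemma C1_derive_continuous s : 0 < s -> {for s, continuous ('D_1 f)}.
Proof.
move=> /posP s0; have [_ c] := Cf.2 1 isT.
exact: (extends_continuous_at open_pos (@subset_closure _ _) c s0).
Qed.

Lemma C1_Dbar s : 0 < s -> Dbar (@pos_reals R) 1 f s = 'D_1 f s.
Proof.
move=> /posP s0; have [_ c] := Cf.2 1 isT.
exact: (DbarE open_pos (@subset_closure _ _) c s0).
Qed.

Variable lambda : R.
Hypothesis lambda0 : 0 < lambda.
Hypothesis ellf : forall s, 0 <= s ->
  lambda <= f s + 2 * s * Dbar (@pos_reals R) 1 f s.

(** At a negative minimum [m] of [f] on [[0, S]] one has [m > 0] since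
    [f 0 >= lambda], and [f' m <= 0] since [m] is minimal among the points to its
    left; then [f m + 2 m f' m < 0]. *)
Lemma elliptic_ge0 S : 0 < S -> 0 <= f S.
Proof.
move=> S0; rewrite leNgt; apply/negP => fS.
have cf : {within `[0, S], continuous f}.
  apply: continuous_subspaceW Cf.1 => s; rewrite /= in_itv /= => /andP[s0 _].
  have -> : @pos_reals R = [set x | 0 < x].
    by apply/seteqP; split => x /posP.
  by rewrite closure_gt.
have [m] := EVT_min (ltW S0) cf; rewrite in_itv /= => /andP[m0 mS] mmin.
have fm : f m < 0.
  by apply: le_lt_trans fS; apply: mmin; rewrite in_itv /= lexx ltW.
have f0 : 0 < f 0.
  by have := ellf (lexx 0); rewrite mulr0 mul0r addr0; exact: lt_le_trans.
have mgt : 0 < m.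
  rewrite lt_neqAle m0 andbT; apply/eqP => m00; move: fm; rewrite -m00.
  by rewrite ltNge ltW.
have dm := @derivableP _ _ _ _ _ _ (C1_derivable mgt).
have dN : is_derive (0 : R) (1 : R) (fun r => - f (m + r *: -1)) ('D_1 f m).
  apply/is_derive_epsP => e /(proj1 (is_derive_epsP _ _ _ _) dm)[r r0 Hr].
  exists r => // h hr; have := Hr (- h); rewrite normrN => /(_ hr).
  rewrite add0r ![_ *: 1]mulr1 [h *: -1]mulrN1 scale0r addr0.
  rewrite -[X in X <= _ -> _]normrN; congr (`|_| <= _); ring.
have : 'D_1 f m <= 0.
  apply: (derive_le_of_upper_parabola (c := 0) mgt dN) => s /andP[s0 sm].
  rewrite scale0r addr0 !mul0r !addr0 lerN2 [s *: -1]mulrN1; apply: mmin.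
  by rewrite in_itv /=; apply/andP; split; lra.
have := ellf (ltW mgt); rewrite C1_Dbar // => H D0.
have : 2 * m * 'D_1 f m <= 0 by rewrite mulr_ge0_le0 // mulr_ge0 // ltW.
by move=> H2; have := lt_le_trans lambda0 H; rewrite ltNge -[X in _ <= X](addr0 0) lerD // ltW.
Qed.

Lemma elliptic_derive_ge0 S : 0 < S -> 0 <= f S + 2 * S * 'D_1 f S.
Proof.
by move=> S0; rewrite -C1_Dbar //; apply: le_trans (ellf (ltW S0)); exact: ltW.
Qed.
End scalar_law.

Section second_order.
Variables (R : realType) (V : normedModType R) (n : nat) (e : 'I_n -> V).

Definition hess_along (g : V -> R) z : 'M[R]_n :=
  \matrix_(j, i) 'D_(e j) ('D_(e i) g) z.

Lemma second_derivative (A : set V) g z v : open A -> A z ->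
  (forall i, C1_along e A ('D_(e i) g)) ->
  is_derive (0 : R) (1 : R)
    (fun s : R => dotv (grad_along e g (z + s *: combine e v)) v)
    (bil (hess_along g z) v v).
Proof.
move=> oA Az C2.
pose G y := \sum_i v 0 i * 'D_(e i) g y.
have -> : (fun s : R => dotv (grad_along e g (z + s *: combine e v)) v) =
   (fun s : R => G (z + s *: combine e v)).
  by apply/funext => s; apply: eq_bigr => i _; rewrite mxE mulrC.
apply: (@is_derive_line R V G); rewrite scale0r addr0.
have -> : bil (hess_along g z) v v =
   \sum_i v 0 i * dotv (grad_along e ('D_(e i) g) z) v.
  apply: eq_bigr => i _; rewrite mxE; congr (_ * _); apply: eq_bigr => j _.
  by rewrite !mxE mulrC.
apply: is_derive_sum_fun => i.
have := @is_deriveZ R V R _ (v 0 i) _ _ _ (is_derive_combine v oA (C2 i) Az).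
by [].
Qed.
End second_order.

(** Differentiability of [f] is asked at [|G x|^2] alone: a law that is smooth on
    the closed half-line only is one-sided at 0, where the gradient vanishes. *)
Lemma divergence_sigma (R : realType) (n : nat) (f : R -> R)
    (G : 'rV[R]_n -> 'rV[R]_n) (H : 'M[R]_n) x :
  derivable f (dotv (G x) (G x)) 1 ->
  (forall i j, is_derive x (basis_vec R j) (fun y => G y 0 i) (H j i)) ->
  divergence (fun y => sigma f (G y)) x = ell_op f ('D_1 f) (G x) H.
Proof.
move=> /derivableP df dG.
have dn j : is_derive x (basis_vec R j) (fun y => dotv (G y) (G y))
    (2 * \sum_i G x 0 i * H j i).
  rewrite /dotv big_distrr /=; apply: is_derive_sum_fun => i.
  have := @is_deriveM _ _ _ _ _ _ _ _ (dG i j) (dG i j).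
  by congr (is_derive _ _ _ _); rewrite /GRing.scale /=; ring.
have dfn j := is_derive_comp1 (g := fun y => dotv (G y) (G y)) df (dn j).
have E i : 'D_(basis_vec R i) (fun y => sigma f (G y) 0 i) x =
    \sum_j coef f ('D_1 f) (G x) i j * H i j.
  have -> : (fun y => sigma f (G y) 0 i) =
      (fun y => f (dotv (G y) (G y))) * (fun y => G y 0 i).
    by apply/funext => y; rewrite /sigma mxE enorm_sqr.
  rewrite (@derive_val _ _ _ _ _ _ _ (is_deriveM (dfn i) (dG i i))).
  rewrite /GRing.scale /= /coef [RHS](bigD1 i) //= eqxx mulr1.
  under [X in _ = _ + X]eq_bigr => j ji do rewrite eq_sym (negbTE ji) mulr0 add0r.
  rewrite (bigD1 i) //=.
  set a := f _; set b := 'D_1 f _; set g := G x 0 i; set h := H i i.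
  have -> : \sum_(j < n | j != i) 2 * b * (g * G x 0 j) * H i j =
      2 * b * g * \sum_(j < n | j != i) G x 0 j * H i j.
    by rewrite big_distrr; apply: eq_bigr => j _ /=; ring.
  ring.
by rewrite /divergence (eq_bigr _ (fun i _ => E i)).
Qed.

(** * Continuity and compactness *)

Section continuity.
Variables (R : realType) (n : nat).

Lemma within_continuous_precomp (X Y Z : topologicalType) (A : set X) (B : set Y)
    (h : X -> Y) (g : Y -> Z) : continuous h -> (forall x, A x -> B (h x)) ->
  {within B, continuous g} -> {within A, continuous (fun x => g (h x))}.
Proof.
move=> ch AB /subspace_continuousP cg; apply/subspace_continuousP => x Ax W Wg.
have /= H := cg (h x) (AB _ Ax) W Wg.
by apply: (@filterS _ (nbhs x) _ _ _ _ (ch x _ H)) => z /= Hz /AB /Hz.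
Qed.

Lemma continuous_dotv (X : topologicalType) (F G : X -> 'rV[R]_n) :
  continuous F -> continuous G -> continuous (fun x => dotv (F x) (G x)).
Proof.
move=> cF cG; have E : (fun x => dotv (F x) (G x)) =
    (fun x => \sum_(i <- index_enum 'I_n) F x 0 i * G x 0 i) by [].
rewrite E; elim: (index_enum _) => [|i s IH] x.
  by under eq_fun do rewrite big_nil; exact: cvg_cst.
under eq_fun do rewrite big_cons; apply: cvgD; last exact: IH.
apply: cvgM.
  exact: (continuous_comp (cF x) (@coord_continuous R 1 n 0 i (F x))).
exact: (continuous_comp (cG x) (@coord_continuous R 1 n 0 i (G x))).
Qed.

Lemma continuous_enorm (X : topologicalType) (F : X -> 'rV[R]_n) :
  continuous F -> continuous (fun x => enorm (F x)).
Proof.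
move=> cF x; apply: (continuous_comp (f := fun x => dotv (F x) (F x))).
  exact: continuous_dotv.
exact: sqrt_continuous.
Qed.

Lemma open_open_cylinder (Omega : set 'rV[R]_n) (T : R) : open Omega ->
  open (open_cylinder Omega T).
Proof.
move=> oO; rewrite openE => -[x t] [/= Ox tT].
exists (Omega, `]0, T[%classic) => //=; split; first exact: open_nbhs_nbhs.
by apply: open_nbhs_nbhs; split => //; exact: interval_open.
Qed.

Lemma open_closed_cylinder (Omega : set 'rV[R]_n) (T : R) :
  open_cylinder Omega T `<=` closed_cylinder Omega T.
Proof.
move=> [x t] [/= Ox]; rewrite in_itv /= => /andP[t0 tT]; split => /=.
  exact: subset_closure.
by rewrite in_itv /= !ltW.
Qed.

Lemma compact_closure_bounded (Omega : set 'rV[R]_n) :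
  bounded_set Omega -> compact (closure Omega).
Proof.
move=> [M [_ HM]]; apply: bounded_closed_compact; last exact: closed_closure.
exists (M + 1); split; first by rewrite num_real.
move=> N MN x clx; rewrite /= leNgt; apply/negP => Nx.
have r0 : 0 < `|x| - N by rewrite subr_gt0.
have [y [Oy]] := clx _ (nbhsx_ballx x _ r0).
rewrite -ball_normE /= => xy.
have yM : `|y| <= M + 1 by apply: (HM (M + 1)) => //; rewrite ltrDl.
have := ler_normD (x - y) y; rewrite subrK; lra.
Qed.

Lemma compact_closed_cylinder (Omega : set 'rV[R]_n) (T : R) :
  bounded_set Omega -> compact (closed_cylinder Omega T).
Proof.
move=> /compact_closure_bounded cO; apply: compact_setX => //.
exact: segment_compact.
Qed.

Lemma enorm_bounded (Omega : set 'rV[R]_n) x0 : bounded_set Omega ->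
  exists2 D : R, 0 <= D & forall x, closure Omega x -> enorm (x - x0) <= D.
Proof.
move=> bO; have [[x1 Ox1]|no] := pselect (closure Omega !=set0); last first.
  by exists 0 => // x cx; exfalso; apply: no; exists x.
have ce : continuous (fun x : 'rV[R]_n => enorm (x - x0)).
  by apply: continuous_enorm => x; apply: (@cvgB _ _ _ (nbhs x) _ id (cst x0)); [exact: cvg_id|exact: cvg_cst].
have [|c _ cmax] := compact_EVT_max _ (compact_closure_bounded bO)
  (continuous_subspaceT ce).
  by exists x1.
exists (enorm (c - x0)) => [|x cx]; first exact: enorm_ge0.
exact/cmax/mem_set.
Qed.
End continuity.

(** * Functions of the parabolic class *)

Section parabolic_class.
Variables (R : realType) (n : nat) (Omega : set 'rV[R]_n) (T : R).
Hypothesis openO : open Omega.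
Variable u : 'rV[R]_n * R -> R.
Hypothesis Cu : C_parabolic Omega T 2 1 u.

Let A := open_cylinder Omega T.
Let B := closed_cylinder Omega T.
Let oA : open A. Proof. exact: open_open_cylinder. Qed.
Let AB : A `<=` B. Proof. exact: open_closed_cylinder. Qed.

Lemma C_parabolic_C1 : C1_along (@dir_x R n) A u.
Proof.
move=> z Az i; have [/= [_ d] c] := Cu.2 [:: i] 0 isT isT.
by split; [exact: d|exact: (extends_continuous_at oA AB c Az)].
Qed.

Lemma C_parabolic_C2 i : C1_along (@dir_x R n) A ('D_(dir_x R i) u).
Proof.
move=> z Az j; have [/= [_ d] c] := Cu.2 [:: j; i] 0 isT isT.
by split; [exact: d|exact: (extends_continuous_at oA AB c Az)].
Qed.

Lemma C_parabolic_Dt z : A z ->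
  is_derive z (dir_t R n) u (Dt Omega T u z).
Proof.
move=> Az; have [/= [_ d] c] := Cu.2 [::] 1 isT isT.
by rewrite /Dt (DbarE oA AB c Az); exact/derivableP/d.
Qed.

Lemma C_parabolic_Dx z : A z -> Dx Omega T u z = grad_along (@dir_x R n) u z.
Proof.
move=> Az; apply/rowP => i; rewrite !mxE.
by have [_ c] := Cu.2 [:: i] 0 isT isT; rewrite (DbarE oA AB c Az).
Qed.

(** On the boundary the gradient exists only as this limit from inside. *)
Lemma cvg_dotv_Dx z v : B z ->
  (fun y => dotv (grad_along (@dir_x R n) u y) v) @ within A (nbhs z)
    --> dotv (Dx Omega T u z) v.
Proof.
move=> Bz.
have -> : (fun y => dotv (grad_along (@dir_x R n) u y) v) =
    (fun y => \sum_(i <- index_enum 'I_n) 'D_(dir_x R i) u y * v 0 i).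
  by apply/funext => y; apply: eq_bigr => i _; rewrite mxE.
have -> : dotv (Dx Omega T u z) v =
    \sum_(i <- index_enum 'I_n) Dbar A (dir_x R i) u z * v 0 i.
  by apply: eq_bigr => i _; rewrite mxE.
elim: (index_enum _) => [|i s IH].
  by under eq_fun do rewrite big_nil; rewrite big_nil; exact: cvg_cst.
under eq_fun do rewrite big_cons; rewrite big_cons; apply: cvgD; last exact: IH.
apply: cvgM; last exact: cvg_cst.
by have [_ c] := Cu.2 [:: i] 0 isT isT; exact: (Dbar_cvg c Bz).
Qed.

Lemma hess_bounded : bounded_set Omega -> exists2 K : R, 0 <= K &
  forall z, A z -> forall i j, `|hess_along (@dir_x R n) u z i j| <= K.
Proof.
move=> bO; have cB : compact B by exact: compact_closed_cylinder.
have H i j : exists M : R, forall z, A z -> `|'D_(dir_x R j) ('D_(dir_x R i) u) z| <= M.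
  have [_ c] := Cu.2 [:: j; i] 0 isT isT.
  exact: (extends_continuously_bounded cB AB c).
have [M MP] : exists M : 'I_n -> 'I_n -> R, forall i j z, A z ->
    `|'D_(dir_x R j) ('D_(dir_x R i) u) z| <= M i j.
  by exists (fun i j => sval (cid (H i j))) => i j; exact: svalP (cid (H i j)).
exists (\sum_i \sum_j `|M i j|) => [|z Az i j].
  by apply: sumr_ge0 => i _; apply: sumr_ge0 => j _.
rewrite mxE; apply: le_trans (MP j i z Az) _; apply: le_trans (ler_norm _) _.
apply: (@le_trans _ _ (\sum_k `|M j k|)).
  by rewrite (bigD1 i) //= lerDl; apply: sumr_ge0.
rewrite [leRHS](bigD1 j) //= lerDl; apply: sumr_ge0 => k _.
by apply: sumr_ge0.
Qed.

Lemma combine_dir_x v : combine (@dir_x R n) v = (v, 0).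
Proof. exact: row_sum_dir_x. Qed.

Lemma dir_x_line (x v : 'rV[R]_n) (t s : R) :
  (x, t) + s *: combine (@dir_x R n) v = (x + s *: v, t).
Proof. by rewrite combine_dir_x; congr (_, _); rewrite /= scaler0 addr0. Qed.

Lemma dir_t_line (x : 'rV[R]_n) (t s : R) :
  (x, t) + s *: dir_t R n = (x, t + s).
Proof. by congr (_, _); rewrite /= ?scaler0 ?addr0 // [_ *: _]mulr1. Qed.

Lemma is_derive_space (x v : 'rV[R]_n) (t s : R) : A (x + s *: v, t) ->
  is_derive s (1 : R) (fun r : R => u (x + r *: v, t))
    (dotv (grad_along (@dir_x R n) u (x + s *: v, t)) v).
Proof.
rewrite -dir_x_line => As.
have := is_derive_line (is_derive_combine v oA C_parabolic_C1 As).
by congr is_derive; apply/funext => r; rewrite dir_x_line.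
Qed.

(** Time runs backwards here because a maximum may occur at the last time
    considered, where only earlier times compare. *)
Lemma is_derive_time (x : 'rV[R]_n) (t : R) : A (x, t) ->
  is_derive (0 : R) (1 : R) (fun r : R => u (x, t - r)) (- Dt Omega T u (x, t)).
Proof.
move=> /C_parabolic_Dt /is_derive_epsP H; apply/is_derive_epsP => e /H[r r0 Hr].
exists r => // h hr; have := Hr (- h); rewrite normrN => /(_ hr).
rewrite dir_t_line add0r [_ *: 1]mulr1 subr0.
by congr (`|_| <= _); ring.
Qed.

(** If the boundary gradient vanishes along an inward direction [v], the mean
    value theorem on the segment inside [Omega] makes [u] stationary at [x] in
    that direction. *)
Lemma neumann_slope (x v : 'rV[R]_n) (t : R) : closure Omega x -> 0 < t < T ->
  dotv (Dx Omega T u (x, t)) v = 0 ->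
  (exists2 r : R, 0 < r & forall s, 0 < s < r -> Omega (x + s *: v)) ->
  forall eta : R, 0 < eta -> exists2 r : R, 0 < r &
    forall s, 0 < s < r -> `|u (x + s *: v, t) - u (x, t)| <= eta * s.
Proof.
move=> clx /andP[t0 tT] D0 [r1 r10 Hr1] eta eta0.
have Bx : B (x, t) by split => //=; rewrite in_itv /= !ltW.
have := @cvg_dotv_Dx (x, t) v Bx; rewrite D0 => /cvgrPdist_le/(_ _ eta0) H.
pose D y := dotv (grad_along (@dir_x R n) u y) v.
have {H} : nbhs (x, t) (fun y => A y -> `|0 - D y| <= eta) := H.
move=> /(small_translate (combine (@dir_x R n) v))[r2 r20 Hr2].
exists (Num.min r1 r2); first by rewrite lt_min r10.
move=> b /andP[b0]; rewrite lt_min => /andP[br1 br2].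
have As s : 0 < s < r1 -> A (x + s *: v, t).
  by move=> /Hr1 Os; split => //=; rewrite in_itv /= t0.
have [||s /andP[s0 sb] E] := @mvt_line R _ u (x, t) (combine (@dir_x R n) v) b b0.
- move=> s /andP[s0 sb]; rewrite dir_x_line.
  have /As/(is_derive_combine v oA C_parabolic_C1)[] // : 0 < s < r1.
  by rewrite s0 (lt_trans sb).
- have -> : (fun s : R => u ((x, t) + s *: combine (@dir_x R n) v)) =
            (fun s : R => u (x + s *: v, t)).
    by apply/funext => s; rewrite dir_x_line.
  apply: (within_continuous_precomp _ _ Cu.1) => [s|s].
    apply: (cvg_pair (G := nbhs (x + s *: v)) (H := nbhs t)); last exact: cvg_cst.
    by apply: cvgD; [exact: cvg_cst|apply: cvgZr_tmp; exact: cvg_id].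
  rewrite /= in_itv /= => /andP[s0 sb].
  have [->|sn0] := eqVneq s 0; first by rewrite scale0r addr0.
  apply: AB; apply: As; rewrite lt_neqAle eq_sym sn0 s0 /=.
  exact: le_lt_trans br1.
have As' : A (x + s *: v, t) by apply: As; rewrite s0 (lt_trans sb).
rewrite -dir_x_line E normrM gtr0_norm // mulrC ler_pM2r //.
rewrite dir_x_line (@derive_val _ _ _ _ _ _ _ (is_derive_combine v oA C_parabolic_C1 As')).
rewrite -dir_x_line -normrN -sub0r; apply: Hr2; last by rewrite dir_x_line.
by rewrite gtr0_norm // (lt_trans sb).
Qed.
End parabolic_class.

(** * Conditions at a maximum of the doubled function *)

(** A quantity that is [o(s)] cannot lie below [- m s + C s^2]. *)
Lemma slope_parabola_absurd (R : realType) (h : R -> R) (m C r1 : R) :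
  0 < m -> 0 < r1 ->
  (forall eta : R, 0 < eta -> exists2 r : R, 0 < r &
    forall s, 0 < s < r -> `|h s| <= eta * s) ->
  ~ (forall s, 0 < s < r1 -> h s <= - m * s + C * s ^+ 2).
Proof.
move=> m0 r10 /(_ _ (divr_gt0 m0 (ltr0Sn _ 1)))[r r0 Hr] H.
have C1 : 0 < `|C| + 1 by rewrite ltr_wpDl.
pose s := Num.min (r / 2) (Num.min (r1 / 2) (m / 4 / (`|C| + 1))).
have s0 : 0 < s by rewrite !lt_min !divr_gt0.
have sr : s < r by rewrite gt_min; apply/orP; left; lra.
have sr1 : s < r1 by rewrite !gt_min; apply/orP; right; apply/orP; left; lra.
have sC : s * (`|C| + 1) <= m / 4.
  by rewrite -ler_pdivlMr // !ge_min lexx !orbT.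
have := Hr s; rewrite s0 sr => /(_ isT); rewrite ler_norml => /andP[H1 _].
have := H s; rewrite s0 sr1 => /(_ isT) H2.
have H3 : C * s ^+ 2 <= m / 4 * s.
  rewrite expr2 mulrA ler_pM2r // mulrC; apply: le_trans sC.
  by rewrite ler_pM2l // (le_trans (ler_norm _)) // lerDl.
have := mulr_gt0 m0 s0; lra.
Qed.

Lemma dotv_shift (R : realType) (n : nat) (a v : 'rV[R]_n) (s : R) :
  dotv (a + s *: v) (a + s *: v) - dotv a a = 2 * s * dotv a v + s ^+ 2 * dotv v v.
Proof. by rewrite !dotvE (dotvC v a); ring. Qed.

(** [L |b|] lies below the quadratic [L (|a|^2 + |b|^2) / (2 |a|)], with contact
    at [b = a]: at a maximum point the distance can be traded for a polynomial. *)
Lemma enorm_shift_le (R : realType) (n : nat) (a b : 'rV[R]_n) (L : R) :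
  0 <= L -> a != 0 ->
  L * (enorm b - enorm a) <= L / enorm a / 2 * (dotv b b - dotv a a).
Proof.
move=> L0; rewrite -enorm_gt0 -!enorm_sqr => a0.
have -> : L / enorm a / 2 * (enorm b ^+ 2 - enorm a ^+ 2) =
   L * (enorm b - enorm a) + L / enorm a / 2 * (enorm b - enorm a) ^+ 2.
  by field; rewrite gt_eqF.
by rewrite lerDl mulr_ge0 ?sqr_ge0 // !divr_ge0 // ltW.
Qed.

Section touching.
Variables (R : realType) (n : nat) (Omega : set 'rV[R]_n) (T : R).
Hypothesis openO : open Omega.
Variable u : 'rV[R]_n * R -> R.
Hypothesis Cu : C_parabolic Omega T 2 1 u.
Variables (x0 : 'rV[R]_n) (k delta eps t1 : R).
Hypotheses (k0 : 0 <= k) (delta0 : 0 < delta) (t1T : t1 < T).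
Variables (x y : 'rV[R]_n) (t : R).
Hypotheses (clx : closure Omega x) (cly : closure Omega y) (tt1 : 0 < t <= t1).

Let e := @dir_x R n.
Let A := open_cylinder Omega T.
Let oA : open A. Proof. exact: open_open_cylinder. Qed.

(** The maximum property at [(x, y, t)] of
    [u(x, t) - u(y, t) - L |x - y|], penalized, after the distance has been
    replaced by a quadratic with [k = L / |x - y|]. *)
Definition quadratic_touching := forall x' y' t',
  closure Omega x' -> closure Omega y' -> 0 <= t' <= t1 ->
  u (x', t') - u (y', t') - (u (x, t) - u (y, t)) <=
    k / 2 * (dotv (x' - y') (x' - y') - dotv (x - y) (x - y))
    + delta / 2 * ((dotv (x' - x0) (x' - x0) - dotv (x - x0) (x - x0))
                 + (dotv (y' - x0) (y' - x0) - dotv (y - x0) (y - x0)))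
    + eps * (t' - t).

Hypothesis touch : quadratic_touching.

Let t0T : 0 < t < T.
Proof. by move: tt1 => /andP[-> /le_lt_trans]; exact. Qed.

Let t01 : 0 <= t <= t1.
Proof. by move: tt1 => /andP[/ltW -> ->]. Qed.

Lemma touching_x s v : closure Omega (x + s *: v) ->
  u (x + s *: v, t) - u (x, t) <=
   (k * dotv (x - y) v + delta * dotv (x - x0) v) * s
   + (k + delta) / 2 * dotv v v * s ^+ 2.
Proof.
move=> cs; have := touch cs cly t01.
have E b : x + s *: v - b = (x - b) + s *: v by rewrite addrAC.
rewrite !E !dotv_shift !subrr mulr0 !addr0.
have -> a b c : u a - u b - (u c - u b) = u a - u c :> R by ring.
by move=> /le_trans; apply; rewrite le_eqVlt; apply/orP; left; apply/eqP; field.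
Qed.

Lemma touching_y s v : closure Omega (y + s *: v) ->
  - (u (y + s *: v, t) - u (y, t)) <=
   (- k * dotv (x - y) v + delta * dotv (y - x0) v) * s
   + (k + delta) / 2 * dotv v v * s ^+ 2.
Proof.
move=> cs; have := touch clx cs t01.
have E : x - (y + s *: v) = (x - y) + s *: - v.
  by rewrite opprD addrA scalerN.
rewrite E (addrAC y) !dotv_shift !subrr mulr0 !addr0 add0r !dotvE.
have -> a b c : u a - u b - (u a - u c) = - (u b - u c) :> R by ring.
by move=> /le_trans; apply; rewrite le_eqVlt; apply/orP; left; apply/eqP; field.
Qed.

(** When both points move by the same vector the distance term does not change;
    only the penalization is left. *)
Lemma touching_xy s v :
  closure Omega (x + s *: v) -> closure Omega (y + s *: v) ->
  u (x + s *: v, t) - u (y + s *: v, t) - (u (x, t) - u (y, t)) <=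
   delta * (dotv (x - x0) v + dotv (y - x0) v) * s + delta * dotv v v * s ^+ 2.
Proof.
move=> csx csy; have := touch csx csy t01.
have -> : (x + s *: v) - (y + s *: v) = x - y by rewrite opprD addrACA subrr addr0.
rewrite !subrr (addrAC x) (addrAC y) !dotv_shift !mulr0 add0r addr0.
by move=> /le_trans; apply; rewrite le_eqVlt; apply/orP; left; apply/eqP; field.
Qed.

Section interior.
Hypothesis convO : @convex_set R 'rV[R]_n Omega.
Hypothesis Ox0 : Omega x0.
Variable nu : 'rV[R]_n -> 'rV[R]_n.
Hypothesis hnu : outer_unit_normal Omega nu.
Hypothesis neumann : forall z s, frontier Omega z -> 0 < s <= T ->
  dotv (Dx Omega T u (z, s)) (nu z) = 0.

Let not_frontier z : closure Omega z -> ~ Omega z -> frontier Omega z.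
Proof. by move=> cz nz; split => //; move: openO => /interior_id ->. Qed.

Let slope z : closure Omega z -> frontier Omega z ->
  forall eta : R, 0 < eta -> exists2 r : R, 0 < r &
    forall s, 0 < s < r -> `|u (z + s *: - nu z, t) - u (z, t)| <= eta * s.
Proof.
move=> cz fz; apply: (neumann_slope openO Cu cz t0T).
  rewrite dotvNr neumann ?oppr0 //.
  by move: t0T => /andP[-> /ltW].
by have [] := outer_normal_convex convO openO hnu fz.
Qed.

(** Along the inner normal at a boundary point the Neumann condition makes [u]
    stationary, convexity makes the distance nonincreasing to first order, and
    the penalization decreases at a positive rate because [x0] is an interior
    point. So the maximum cannot be there. *)
Lemma touching_interior_x : Omega x.
Proof.
apply: contrapT => nx; have fx := not_frontier clx nx.
have [Hcl /(_ _ Ox0) H0 [r r0 Hr]] := outer_normal_convex convO openO hnu fx.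
apply: (slope_parabola_absurd (mulr_gt0 delta0 H0) r0 (slope clx fx)
  (C := (k + delta) / 2 * dotv (- nu x) (- nu x))) => s sr.
have := touching_x (subset_closure (Hr s sr)); move=> /le_trans; apply.
rewrite lerD2r; apply: ler_wpM2r; first by case/andP: sr => /ltW.
have := mulr_ge0 k0 (Hcl _ cly); rewrite !dotvNr; lra.
Qed.

(** The argument of [touching_interior_x] with the roles of the points
    exchanged. *)
Lemma touching_interior_y : Omega y.
Proof.
apply: contrapT => ny; have fy := not_frontier cly ny.
have [Hcl /(_ _ Ox0) H0 [r r0 Hr]] := outer_normal_convex convO openO hnu fy.
have slopeN : forall eta : R, 0 < eta -> exists2 r : R, 0 < r &
    forall s, 0 < s < r -> `|- (u (y + s *: - nu y, t) - u (y, t))| <= eta * s.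
  by move=> eta /(slope cly fy)[q q0 Hq]; exists q => // s /Hq; rewrite normrN.
apply: (slope_parabola_absurd (mulr_gt0 delta0 H0) r0 slopeN
  (C := (k + delta) / 2 * dotv (- nu y) (- nu y))) => s sr.
have := touching_y (subset_closure (Hr s sr)); move=> /le_trans; apply.
rewrite lerD2r; apply: ler_wpM2r; first by case/andP: sr => /ltW.
have := mulr_ge0 k0 (Hcl _ clx); rewrite -(opprB y x) !dotvE; lra.
Qed.
End interior.

Section conditions.
Hypotheses (Ox : Omega x) (Oy : Omega y).

Let Axt : A (x, t). Proof. by split => //=; rewrite in_itv. Qed.
Let Ayt : A (y, t). Proof. by split => //=; rewrite in_itv. Qed.

Let line_in z v : Omega z -> exists2 r : R, 0 < r &
  forall s : R, `|s| < r -> Omega (z + s *: v).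
Proof. by move=> Oz; apply/small_translate/open_nbhs_nbhs. Qed.

Let in_A z s v : Omega (z + s *: v) -> A (z + s *: v, t).
Proof. by move=> Oz; split => //=; rewrite in_itv. Qed.

Let D2 z v : A (z, t) -> is_derive (0 : R) (1 : R)
    (fun s : R => dotv (grad_along e u (z + s *: v, t)) v)
    (bil (hess_along e u (z, t)) v v).
Proof.
move=> Az; have := second_derivative v oA Az (C_parabolic_C2 openO Cu).
by congr is_derive; apply/funext => s; rewrite dir_x_line.
Qed.

Lemma touching_grad_x :
  grad_along e u (x, t) = k *: (x - y) + delta *: (x - x0).
Proof.
apply/rowP => i; rewrite -(dotv_basis _ i) -[RHS](dotv_basis _ i).
set v := basis_vec R i; have [r r0 Hr] := line_in v Ox.
have [||+ _] := @parabola_touch R (fun s => u (x + s *: v, t))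
  (fun s => dotv (grad_along e u (x + s *: v, t)) v) _
  (k * dotv (x - y) v + delta * dotv (x - x0) v)
  ((k + delta) / 2 * dotv v v) r r0 _ (D2 v Axt).
- by move=> s /Hr /in_A As; exact: (is_derive_space openO Cu As).
- move=> s /Hr Os; have := touching_x (subset_closure Os).
  by rewrite scale0r addr0 lerBlDl addrA.
by rewrite scale0r addr0 => ->; rewrite !dotvE.
Qed.

Lemma touching_grad_y :
  grad_along e u (y, t) = k *: (x - y) - delta *: (y - x0).
Proof.
apply/rowP => i; rewrite -(dotv_basis _ i) -[RHS](dotv_basis _ i).
set v := basis_vec R i; have [r r0 Hr] := line_in v Oy.
have [||+ _] := @parabola_touch R (fun s => - u (y + s *: v, t))
  (fun s => - dotv (grad_along e u (y + s *: v, t)) v) _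
  (- k * dotv (x - y) v + delta * dotv (y - x0) v)
  ((k + delta) / 2 * dotv v v) r r0 _ (is_deriveN (D2 v Ayt)).
- move=> s /Hr /in_A As.
  by have := is_deriveN (is_derive_space openO Cu As).
- move=> s /Hr Os; have := touching_y (subset_closure Os).
  by rewrite scale0r addr0 opprB; lra.
rewrite scale0r addr0 !dotvE; lra.
Qed.

(** Translating both points together cancels the distance, so the difference of
    the Hessians is bounded by the penalization alone. This is why two spatial
    derivatives of [u] suffice. *)
Lemma touching_hess v :
  bil (hess_along e u (x, t) - hess_along e u (y, t)) v v
    <= 2 * delta * dotv v v.
Proof.
have [r r0 Hr] := line_in v Ox; have [q q0 Hq] := line_in v Oy.
have rq0 : 0 < Num.min r q by rewrite lt_min r0.
have [||_] := @parabola_touch R (fun s => u (x + s *: v, t) - u (y + s *: v, t))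
  (fun s => dotv (grad_along e u (x + s *: v, t)) v
          - dotv (grad_along e u (y + s *: v, t)) v) _
  (delta * (dotv (x - x0) v + dotv (y - x0) v))
  (delta * dotv v v) _ rq0 _ (is_deriveB (D2 v Axt) (D2 v Ayt)).
- move=> s; rewrite lt_min => /andP[/Hr /in_A As /Hq /in_A As'].
  by have := is_deriveB (is_derive_space openO Cu As) (is_derive_space openO Cu As').
- move=> s; rewrite lt_min => /andP[/Hr /subset_closure cs /Hq /subset_closure cs'].
  have := touching_xy cs cs'; rewrite !scale0r !addr0; lra.
by rewrite mulrA /bil mulmxBr dotvBr.
Qed.

Lemma touching_time : eps <= Dt Omega T u (x, t) - Dt Omega T u (y, t).
Proof.
have [t0 tl] := andP tt1.
have D1 := is_deriveB (is_derive_time openO Cu Axt) (is_derive_time openO Cu Ayt).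
have := @derive_le_of_upper_parabola R
  (fun s => u (x, t - s) - u (y, t - s)) _ (- eps) 0 t t0 D1.
suff H : forall s, 0 < s < t -> u (x, t - s) - u (y, t - s) <=
    u (x, t - 0) - u (y, t - 0) + - eps * s + 0 * s ^+ 2.
  by move=> /(_ H); rewrite opprK addrC -lerN2 opprK opprB.
move=> s /andP[s0 st]; have t's : 0 <= t - s <= t1 by apply/andP; split; lra.
have := touch clx cly t's; rewrite !subrr !mulr0 !addr0 mulr0 subr0; lra.
Qed.
End conditions.
End touching.

(** * The two-point maximum principle *)

Section two_point.
Variables (R : realType) (n : nat) (Omega : set 'rV[R]_n) (T : R).
Hypothesis openO : open Omega.
Hypothesis bddO : bounded_set Omega.
Hypothesis convO : @convex_set R 'rV[R]_n Omega.
Variable nu : 'rV[R]_n -> 'rV[R]_n.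
Hypothesis hnu : outer_unit_normal Omega nu.
Variable u : 'rV[R]_n * R -> R.
Hypothesis Cu : C_parabolic Omega T 2 1 u.
Hypothesis neumann : forall z s, frontier Omega z -> 0 < s <= T ->
  dotv (Dx Omega T u (z, s)) (nu z) = 0.
Variables (f c : R -> R) (lambda : R).
Hypothesis Cf : C_nonneg 1 f.
Hypothesis lambda0 : 0 < lambda.
Hypothesis ellf : forall s, 0 <= s ->
  lambda <= f s + 2 * s * Dbar (@pos_reals R) 1 f s.
Hypothesis c_ge0 : forall t, 0 <= t <= T -> 0 <= c t.
Hypothesis pde : forall x t, Omega x -> 0 < t <= T ->
  Dt Omega T u (x, t) =
    divergence (fun y => sigma f (Dx Omega T u (y, t))) x - c t * u (x, t).

Let e := @dir_x R n.
Let A := open_cylinder Omega T.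
Let oA : open A. Proof. exact: open_open_cylinder. Qed.

Lemma pde_nondivergence x t : A (x, t) -> grad_along e u (x, t) != 0 ->
  Dt Omega T u (x, t) =
    ell_op f ('D_1 f) (grad_along e u (x, t)) (hess_along e u (x, t))
    - c t * u (x, t).
Proof.
move=> Axt p0; have [/= Ox] := Axt; rewrite in_itv /= => /andP[t0 tT].
rewrite pde // ?t0 ?ltW //; congr (_ - _).
rewrite -(C_parabolic_Dx openO Cu Axt); apply: divergence_sigma.
  apply: (C1_derivable Cf).
  by rewrite (C_parabolic_Dx openO Cu Axt) -enorm_sqr exprn_gt0 // enorm_gt0.
move=> i j; rewrite mxE.
have dj : is_derive x (basis_vec R j) (fun y => 'D_(dir_x R i) u (y, t))
    ('D_(dir_x R j) ('D_(dir_x R i) u) (x, t)).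
  apply: (@is_derive_dir_x R n ('D_(dir_x R i) u)); apply: derivableP.
  exact: (C_parabolic_C2 openO Cu i Axt j).1.
apply: near_eq_is_derive dj.
apply: filterS (open_nbhs_nbhs (conj openO Ox)) => y Oy.
have Ayt : A (y, t) by split => //=; rewrite in_itv /= t0.
by rewrite (C_parabolic_Dx openO Cu Ayt) mxE.
Qed.

(** The [delta] term keeps maxima off the boundary, the [eps] term makes the
    time derivative strictly positive at a maximum. *)
Definition doubled (x0 : 'rV[R]_n) (L delta eps : R) (z : ('rV[R]_n * 'rV[R]_n) * R) : R :=
  u (z.1.1, z.2) - u (z.1.2, z.2) - L * enorm (z.1.1 - z.1.2)
  - delta / 2 * (dotv (z.1.1 - x0) (z.1.1 - x0) + dotv (z.1.2 - x0) (z.1.2 - x0))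
  - eps * z.2.

Lemma continuous_doubled x0 L delta eps t1 : t1 <= T ->
  {within (closure Omega `*` closure Omega) `*` `[0, t1], continuous (doubled x0 L delta eps)}.
Proof.
move=> t1T.
have c11 : continuous (fun z : ('rV[R]_n * 'rV[R]_n) * R => z.1.1).
  by move=> z; apply: (continuous_comp (f := fst) (g := fst)); exact: cvg_fst.
have c12 : continuous (fun z : ('rV[R]_n * 'rV[R]_n) * R => z.1.2).
  by move=> z; apply: (continuous_comp (f := fst) (g := snd)); [exact: cvg_fst|exact: cvg_snd].
have c2 : continuous (fun z : ('rV[R]_n * 'rV[R]_n) * R => z.2).
  by move=> z; exact: cvg_snd.
have cB (h : ('rV[R]_n * 'rV[R]_n) * R -> 'rV[R]_n) : continuous h -> continuous (fun z : ('rV[R]_n * 'rV[R]_n) * R => h z - x0).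
  by move=> ch z; apply: cvgB; [exact: ch|exact: cvg_cst].
have cM (a : R) (h : ('rV[R]_n * 'rV[R]_n) * R -> R) : continuous h -> continuous (fun z : ('rV[R]_n * 'rV[R]_n) * R => a * h z).
  by move=> ch z; apply: cvgM; [exact: cvg_cst|exact: ch].
have cA (h g : ('rV[R]_n * 'rV[R]_n) * R -> R) : continuous h -> continuous g ->
    continuous (fun z => h z + g z).
  by move=> ch cg z; apply: cvgD; [exact: ch|exact: cg].
have cS (h g : ('rV[R]_n * 'rV[R]_n) * R -> 'rV[R]_n) : continuous h -> continuous g ->
    continuous (fun z => h z - g z).
  by move=> ch cg z; apply: cvgB; [exact: ch|exact: cg].
have cu (h : ('rV[R]_n * 'rV[R]_n) * R -> 'rV[R]_n) : continuous h -> (forall z, closure Omega z.1.1 -> closure Omega z.1.2 -> closure Omega (h z)) ->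
    {within (closure Omega `*` closure Omega) `*` `[0, t1], continuous (fun z => u (h z, z.2))}.
  move=> ch hz; apply: (within_continuous_precomp _ _ Cu.1) => [z|z [/= [z1 z2]]].
    by apply: (cvg_pair (G := nbhs (h z)) (H := nbhs z.2)); [exact: ch|exact: c2].
  rewrite in_itv /= => /andP[z0 zt]; split => /=; first exact: (hz z z1 z2).
  by rewrite in_itv /= z0 (le_trans zt).
apply: within_continuousB; last by apply: continuous_subspaceT; exact: cM.
apply: within_continuousB; last first.
  apply: continuous_subspaceT; apply: cM.
  exact: (cA _ _ (continuous_dotv (cB _ c11) (cB _ c11))
                 (continuous_dotv (cB _ c12) (cB _ c12))).
apply: within_continuousB; last first.
  apply: continuous_subspaceT; apply: cM; exact: (continuous_enorm (cS _ _ c11 c12)).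
apply: within_continuousB; first exact: (cu _ c11 (fun z a _ => a)).
exact: (cu _ c12 (fun z _ b => b)).
Qed.

(** At a positive maximum of [doubled] both points are interior, both gradients
    are within [delta D] of one vector [P] of length [L], the Hessian at [x]
    exceeds that at [y] by at most [2 delta], and [u_t(x) - u_t(y) >= eps].
    Subtracting the equations at the two points bounds [eps] by terms that are
    small with [delta]; the zeroth order term has a favourable sign since
    [c >= 0] and [u(x) > u(y)]. *)
Lemma lipschitz_preserved (L t1 : R) (x1 y1 : 'rV[R]_n) : 0 < L -> 0 < t1 < T ->
  (forall x y, closure Omega x -> closure Omega y ->
     u (x, 0) - u (y, 0) <= L * enorm (x - y)) ->
  Omega x1 -> Omega y1 -> u (x1, t1) - u (y1, t1) <= L * enorm (x1 - y1).
Proof.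
have half (a b : R) : a <= b / 8 -> 2 * a <= b / 4 by lra.
have far (l d D a : R) : l * l + d * a = 0 -> d * - a <= d * (D * l) ->
    d * D * l <= l / 2 * l -> 0 < l * l -> False.
  by lra.
(* The final contradiction, isolated as linear arithmetic: [ct * a] and [ct * b]
   are the zeroth order terms and [d] bounds the Hessian contribution. *)
have balance (Ex Ey Fx Fy ct a b d eps : R) :
    eps <= Ex - ct * a - (Ey - ct * b) -> 0 <= ct * (a - b) ->
    Fx - Fy <= d -> Ex - Fx <= eps / 8 -> - (Ey - Fy) <= eps / 8 ->
    d <= eps / 4 -> 0 < eps -> False.
  by lra.
move=> L0 /andP[t10 t1T] init Ox1 Oy1; rewrite leNgt; apply/negP => w0.
rewrite -subr_gt0 in w0; set w := _ - _ - _ in w0.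
have [eps eps0 epst1] : exists2 eps : R, 0 < eps & eps * t1 = w / 4.
  exists (w / (4 * t1)); first by rewrite divr_gt0 // mulr_gt0.
  by field; rewrite gt_eqF.
have [D D0 HD] := enorm_bounded x1 bddO.
have [K K0 HK] := hess_bounded Cu bddO.
have L20 : 0 < L ^+ 2 by rewrite exprn_gt0.
(* [eta] bounds the change of the coefficients when each gradient is replaced by
   [P]; the resulting error is multiplied by the [n^2] entries of size [K]. *)
pose eta := eps / 8 / (n%:R ^+ 2 * K + 1).
have nK : 0 < n%:R ^+ 2 * K + 1 by rewrite ltr_wpDl // mulr_ge0 // sqr_ge0.
have eta0 : 0 < eta by rewrite !divr_gt0.
have etaK : n%:R ^+ 2 * (eta * K) <= eps / 8.
  have -> : n%:R ^+ 2 * (eta * K) = eta * (n%:R ^+ 2 * K + 1) - eta by ring.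
  by rewrite /eta divfK ?gt_eqF // lerBlDr lerDl ltW.
have [r r0 Hr] := @coef_close R n f ('D_1 f) L eta L0 eta0 (C1_continuous Cf L20) (C1_derive_continuous Cf L20).
pose c0 := n%:R * f (L ^+ 2) + 2 * L ^+ 2 * 'D_1 f (L ^+ 2).
have D10 : 0 < D + 1 by rewrite ltr_wpDl.
have D20 : 0 < D ^+ 2 + 1 by rewrite ltr_wpDl // sqr_ge0.
have c10 : 0 < `|c0| + 1 by rewrite ltr_wpDl.
(* The four conditions keep the maximum positive, make [eta] available, keep the
   gradients away from 0, and absorb the Hessian contribution. *)
have [delta [delta0 d1 d2 d3 d4]] : exists delta : R, [/\ 0 < delta,
    delta * (D ^+ 2 + 1) <= w / 4, delta * (D + 1) <= r,
    delta * (D + 1) <= L / 2 & delta * (`|c0| + 1) <= eps / 8].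
  exists (Num.min (w / 4 / (D ^+ 2 + 1)) (Num.min (r / (D + 1))
    (Num.min (L / 2 / (D + 1)) (eps / 8 / (`|c0| + 1))))).
  by rewrite -!ler_pdivlMr // !lt_min !ge_min !divr_gt0 // !lexx !orbT.
have dD : delta * D <= delta * (D + 1) by rewrite ler_pM2l // lerDl.
have clx1 := subset_closure Ox1; have cly1 := subset_closure Oy1.
have [|[[x y] t] /set_mem[[/= clx cly] tin] Hmax] := compact_EVT_max _
  (compact_setX (compact_setX (compact_closure_bounded bddO) (compact_closure_bounded bddO))
     (@segment_compact R 0 t1))
  (@continuous_doubled x1 L delta eps t1 (ltW t1T)).
  by exists ((x1, y1), t1); split => //=; rewrite in_itv /= lexx ltW.
have {}tin : 0 <= t <= t1 by move: tin; rewrite /= in_itv.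
have {}Hmax x' y' t' : closure Omega x' -> closure Omega y' -> 0 <= t' <= t1 ->
    doubled x1 L delta eps ((x', y'), t') <= doubled x1 L delta eps ((x, y), t).
  by move=> cx cy t't; apply: Hmax; rewrite inE; split => //=; rewrite in_itv.
have sqD z : closure Omega z -> dotv (z - x1) (z - x1) <= D ^+ 2.
  by move=> /HD zD; rewrite -enorm_sqr lerXn2r // nnegrE enorm_ge0.
have Mpos : L * enorm (x - y) < u (x, t) - u (y, t).
  have := Hmax x1 y1 t1 clx1 cly1; rewrite lexx ltW // => /(_ isT).
  rewrite /doubled /= subrr => H.
  have := sqD y1 cly1; have := dotv_ge0 (x - x1); have := dotv_ge0 (y - x1) => h1 h2 h3.
  have h4 : delta / 2 * (dotv (0 : 'rV[R]_n) 0 + dotv (y1 - x1) (y1 - x1)) <= w / 4.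
    apply: (le_trans _ d1).
    have -> : dotv (0 : 'rV[R]_n) 0 = 0 by rewrite -(scale0r x1) dotvZl mul0r.
    rewrite add0r.
    rewrite -mulrA ler_pM2l //; have := dotv_ge0 (y1 - x1); lra.
  have h5 : 0 <= delta / 2 * (dotv (x - x1) (x - x1) + dotv (y - x1) (y - x1)).
    by rewrite mulr_ge0 ?addr_ge0 ?divr_ge0 // ltW.
  have h6 : 0 <= eps * t by case/andP: tin => h _; rewrite mulr_ge0 // ltW.
  rewrite epst1 in H; rewrite -subr_gt0.
  move: H h4; rewrite -/w; move: w0; lra.
have t0 : 0 < t.
  case/andP: tin => t0 _; rewrite lt_neqAle t0 andbT; apply/eqP => tt.
  by move: Mpos; rewrite -tt ltNge init.
have tt1 : 0 < t <= t1 by rewrite t0; case/andP: tin.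
have d_neq0 : x - y != 0.
  apply/eqP => xy0; move: Mpos; have -> : x = y by apply/eqP; rewrite -subr_eq0 xy0.
  by rewrite !subrr ltNge mulr_ge0 // ?enorm_ge0 // ltW.
have dn : 0 < enorm (x - y) by rewrite enorm_gt0.
pose k := L / enorm (x - y).
have k0 : 0 <= k by rewrite divr_ge0 // ltW.
have touch : quadratic_touching Omega u x1 k delta eps t1 x y t.
  move=> x' y' t' cx cy t't; have := Hmax x' y' t' cx cy t't.
  have := enorm_shift_le (x' - y') (ltW L0) d_neq0; rewrite /doubled /= -/k; lra.
have Ox := touching_interior_x openO Cu k0 delta0 t1T clx cly tt1 touch convO Ox1 hnu neumann.
have Oy := touching_interior_y openO Cu k0 delta0 t1T clx cly tt1 touch convO Ox1 hnu neumann.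
have px := touching_grad_x openO Cu t1T cly tt1 touch Ox.
have py := touching_grad_y openO Cu t1T clx tt1 touch Oy.
have Hv := touching_hess openO Cu t1T tt1 touch Ox Oy.
have Ht := touching_time openO Cu t1T clx cly tt1 touch Ox Oy.
set P := k *: (x - y) in px py.
have PL : enorm P = L by rewrite enormZ ger0_norm // /k divfK // gt_eqF.
have PP : dotv P P = L ^+ 2 by rewrite -enorm_sqr PL.
have close_neq0 p q : p = P + delta *: q -> enorm q <= D ->
    p != 0 /\ (forall i j, `|coef f ('D_1 f) p i j - coef f ('D_1 f) P i j| <= eta).
  move=> pE qD; split.
    apply/eqP => p0; have : dotv p P = 0 by rewrite p0 -(scale0r P) dotvZl mul0r.
    rewrite pE dotvDl (dotvZl delta) PP => H.
    have := dotv_le_enorm (- q) P; rewrite enormN PL dotvNl => H2.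
    have H3 : delta * - dotv q P <= delta * (D * L).
      by rewrite ler_pM2l // (le_trans H2) // ler_pM2r.
    have H4 : delta * D * L <= L / 2 * L by rewrite ler_pM2r // (le_trans dD).
    by rewrite expr2 in H; case: (far L delta D (dotv q P) H H3 H4 (mulr_gt0 L0 L0)).
  apply: Hr => // i; rewrite pE !mxE addrAC subrr add0r normrM gtr0_norm //.
  apply: le_trans d2; apply: le_trans dD; rewrite ler_pM2l //.
  exact: le_trans (normr_coord_le _ _) qD.
have [px0 cx] := close_neq0 _ _ px (HD _ clx).
have [py0 cy] : grad_along e u (y, t) != 0 /\
   (forall i j, `|coef f ('D_1 f) (grad_along e u (y, t)) i j - coef f ('D_1 f) P i j| <= eta).
  by apply: (close_neq0 _ (- (y - x1))); rewrite ?enormN ?HD // scalerN.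
have Axt z : Omega z -> A (z, t).
  move=> Oz; split => //=; rewrite in_itv /= t0 /=.
  by apply: le_lt_trans t1T; case/andP: tin.
move: Ht; rewrite (pde_nondivergence (Axt _ Ox) px0) (pde_nondivergence (Axt _ Oy) py0).
have := ell_op_close (HK _ (Axt _ Ox)) cx; have := ell_op_close (HK _ (Axt _ Oy)) cy.
have P0 : P != 0 by rewrite -enorm_gt0 PL.
have := @ell_op_le R n f ('D_1 f) P _ (2 * delta) P0 _ _ Hv.
rewrite PP (elliptic_ge0 Cf lambda0 ellf L20) => /(_ isT).
rewrite (elliptic_derive_ge0 Cf lambda0 ellf L20) => /(_ isT).
rewrite -/c0 ell_opB.
move=> HF Hy Hx Ht.
have ct : 0 <= c t * (u (x, t) - u (y, t)).
  apply: mulr_ge0.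
    apply: c_ge0; rewrite ltW //=; apply: ltW; apply: le_lt_trans t1T.
    by case/andP: tin.
  by apply: ltW; apply: le_lt_trans Mpos; rewrite mulr_ge0 // ltW.
have Hc : 2 * delta * c0 <= eps / 4.
  rewrite -mulrA; apply: half; apply: le_trans d4.
  by rewrite ler_pM2l // (le_trans (ler_norm _)) // lerDl.
have [_ hx] := ler_normlP _ _ (le_trans Hx etaK).
have [hy _] := ler_normlP _ _ (le_trans Hy etaK).
by case: (balance _ _ _ _ _ _ _ _ _ Ht ct HF hx hy Hc eps0).
Qed.
End two_point.

(** * Null sets *)

Section null_sets.
Variable R : realType.

(** The inequality between indicator functions is integrated in one coordinate at
    a time; monotone convergence exchanges the series with each integral, and
    the weights [g] carry the lengths already integrated. *)
Lemma box_cover_volume (I : finType) (p q : I -> R) (a b : nat -> I -> R)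
    (s : seq I) (w : R) (g : nat -> R) :
  (forall i, p i < q i) -> (forall k i, a k i <= b k i) ->
  uniq s -> 0 <= w -> (forall k, 0 <= g k) ->
  (forall x : I -> R, (forall i, p i < x i < q i) ->
     (w%:E <= \sum_(0 <= k <oo)
        (g k * \prod_(i <- s) \1_(`]a k i, b k i[) (x i))%:E)%E) ->
  ((w * \prod_(i <- s) (q i - p i))%:E <=
     \sum_(0 <= k <oo) (g k * \prod_(i <- s) (b k i - a k i))%:E)%E.
Proof.
move=> pq ab; elim: s w g => [|j s IH] w g /=.
  move=> _ w0 g0 /(_ (fun i => (p i + q i) / 2)); rewrite !big_nil mulr1.
  under eq_eseriesr do rewrite big_nil.
  under [X in _ -> (_ <= X)%E]eq_eseriesr do rewrite big_nil.
  by apply => i; have := pq i => pqi; apply/andP; split; lra.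
move=> /andP[js us] w0 g0 H.
have qp0 : 0 <= q j - p j by rewrite subr_ge0 ltW.
have ba0 k : 0 <= b k j - a k j by rewrite subr_ge0.
rewrite big_cons mulrA.
under eq_eseriesr do rewrite big_cons mulrA.
apply: IH => //; [exact: mulr_ge0| by move=> k; exact: mulr_ge0|].
move=> x xpq.
pose c k := g k * \prod_(i <- s) \1_(`]a k i, b k i[) (x i).
have c0 k : 0 <= c k.
  by apply: mulr_ge0 => //; apply: prodr_ge0 => i _; rewrite indicE ler0n.
pose A k : set R := `]a k j, b k j[%classic.
have mA k : measurable (A k) by exact: measurable_itv.
pose D : set R := `]p j, q j[%classic.
have mD : measurable D by exact: measurable_itv.
have H1 t : D t -> (w%:E <= \sum_(0 <= k <oo) ((c k)%:E * (\1_(A k) t)%:E))%E.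
  rewrite /D /= in_itv /= => tpq.
  have := H (fun i => if i == j then t else x i).
  have xt i : p i < (if i == j then t else x i) < q i by case: eqP => [->|_].
  move=> /(_ xt); congr (_ <= _)%E; apply: eq_eseriesr => k _.
  rewrite big_cons eqxx mulrCA EFinM muleC /c; congr (_ * _)%E.
  congr ((_ * _)%:E); apply: eq_big_seq => i si.
  by case: eqP => // ij; rewrite -ij si in js.
have mf k : measurable_fun D (fun t => (\1_(A k) t)%:E : \bar R).
  apply/measurable_EFinP; apply: measurable_indic. exact: mA.
have H2 : (\int[@lebesgue_measure R]_(t in D) (cst w%:E t) <=
   \int[@lebesgue_measure R]_(t in D)
     (\sum_(0 <= k <oo) ((c k)%:E * (\1_(A k) t)%:E)))%E.
  apply: ge0_le_integral => //.
    apply: ge0_emeasurable_sum => [k t Dt _|k _].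
      by rewrite -EFinM lee_fin mulr_ge0.
    apply: measurable_funeM; exact: (mf k).
move: H2; rewrite integral_cst // integral_nneseries //; first last.
- by move=> k t _; rewrite -EFinM lee_fin mulr_ge0.
- by move=> k; apply: measurable_funeM; exact: (mf k).
have mD_ : lebesgue_measure D = (q j - p j)%:E.
  by rewrite lebesgue_measure_itv /= lte_fin pq EFinB.
move=> H2; rewrite EFinM -mD_; apply: le_trans H2 _.
apply: lee_nneseries => [k _ _|k _].
  by apply: integral_ge0 => t _; rewrite -EFinM lee_fin mulr_ge0.
have -> : (\int[@lebesgue_measure R]_(t in D) ((c k)%:E * (\1_(A k) t)%:E) =
    (c k)%:E * lebesgue_measure (A k `&` D))%E.
  rewrite -integral_indic //.
  have := @ge0_integralZl _ _ R lebesgue_measure D mD (fun t => (\1_(A k) t)%:E) (mf k) (c k)%:E.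
  apply; last by rewrite lee_fin.
  by move=> t _; rewrite lee_fin.
  exact: mA.
rewrite [X in (_ <= X%:E)%E]mulrAC -/(c k) [leRHS]EFinM.
rewrite lee_wpmul2l ?lee_fin //.
apply: (@le_trans _ _ (lebesgue_measure (A k))).
  apply: le_measure; rewrite ?inE; last exact: subIsetl; last exact: mA.
  by apply: measurableI; [exact: mA|exact: mD].
rewrite lebesgue_measure_itv /= lte_fin -EFinD.
by case: ltP => // _; rewrite lee_fin.
Qed.

(** A countable cover of the cube by boxes has total volume at least that of the
    cube. *)
Lemma not_lebesgue_null_ball (m : nat) (N : set 'rV[R]_m) (z : 'rV[R]_m)
    (r : R) : 0 < r ->
  (forall x : 'rV[R]_m, (forall i, `|x 0 i - z 0 i| < r) -> N x) ->
  ~ lebesgue_null N.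
Proof.
move=> r0 zN nN.
pose v : R := \prod_(i < m) (2 * r).
have v0 : 0 < v by apply: prodr_gt0 => i _; rewrite mulr_gt0.
have [a [b [ab cov le_v]]] := nN (v / 2) (divr_gt0 v0 (ltr0Sn _ 1)).
have := @box_cover_volume 'I_m (fun i => z 0 i - r) (fun i => z 0 i + r)
  (fun k => a k 0) (fun k => b k 0) (index_enum 'I_m) 1 (fun=> 1) _ ab
  (index_enum_uniq _) ler01 (fun=> ler01).
have pq i : z 0 i - r < z 0 i + r by lra.
move=> /(_ pq) H; suff : (v%:E <= (v / 2)%:E)%E by rewrite lee_fin; lra.
apply: le_trans le_v; have -> : v = 1 * \prod_(i < m) (z 0 i + r - (z 0 i - r)).
  by rewrite mul1r; apply: eq_bigr => i _; ring.
apply: le_trans (H _) _; last by under eq_eseriesr do rewrite mul1r.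
move=> x xz.
pose X : 'rV[R]_m := \row_i x i.
have [k _ Xk] : (\bigcup_k box (a k) (b k)) X.
  apply: cov; apply: zN => i; rewrite mxE ltr_distl.
  by have := xz i.
have t0 l : (0 <= (\prod_(i < m) \1_(`]a l 0 i, b l 0 i[) (x i))%:E :> \bar R)%E.
  by rewrite lee_fin; apply: prodr_ge0 => i _; rewrite indicE ler0n.
rewrite (nneseriesD1 (P := xpredT) (n := k)) //; last by move=> l _; rewrite mul1r.
rewrite mul1r big1 => [|i _]; first last.
  by rewrite indicE mem_set //= in_itv /=; have := Xk i; rewrite mxE.
by rewrite leeDl // nneseries_ge0 // => l _ _; rewrite mul1r.
Qed.

Lemma lebesgue_null_set0 (m : nat) : lebesgue_null (set0 : set 'rV[R]_m.+1).
Proof.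
move=> e e0; exists (fun=> 0), (fun=> 0); split => //.
rewrite eseries0 ?lee_fin ?ltW // => k _ _.
by rewrite big_ord_recl subrr mul0r.
Qed.
End null_sets.

(** * Essential bounds and limits *)

Section essential_bounds.
Variable R : realType.

Lemma lebesgue_null_nbhs (m : nat) (N : set 'rV[R]_m) (z : 'rV[R]_m) :
  nbhs z N -> ~ lebesgue_null N.
Proof.
move=> /nbhs_ballP[r /= r0 zN]; apply: (@not_lebesgue_null_ball R m N z r r0) => x xz.
apply: zN; split => // i j; rewrite (ord1 i) /ball /= distrC; exact: xz.
Qed.

Lemma lebesgue_null_space_time (n : nat) (N : set ('rV[R]_n * R)) (y : 'rV[R]_n * R) :
  nbhs y N -> ~ lebesgue_null (@space_time R n @^-1` N).
Proof.
case: y => x t /nbhs_ballP[r /= r0 yN].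
pose z : 'rV[R]_(n + 1) := row_mx x (const_mx t).
apply: (@not_lebesgue_null_ball R _ _ z r r0) => w wz; apply: yN.
split => /=.
  split => // i j; rewrite (ord1 i) /ball /= distrC mxE.
  by have := wz (lshift 1 j); rewrite row_mxEl.
rewrite /ball /= distrC mxE.
by have := wz (rshift n 0); rewrite row_mxEr mxE.
Qed.
End essential_bounds.

Lemma continuous_enorm_grad (R : realType) (V : normedModType R) (n : nat)
    (e : 'I_n -> V) (A : set V) (g : V -> R) z : C1_along e A g -> A z ->
  {for z, continuous (fun y => enorm (grad_along e g y))}.
Proof.
move=> gA Az.
apply: (continuous_comp (f := fun y => dotv (grad_along e g y) (grad_along e g y)));
  last exact: sqrt_continuous.
have E : (fun y => dotv (grad_along e g y) (grad_along e g y)) =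
   (fun y => \sum_(i <- index_enum 'I_n) 'D_(e i) g y * 'D_(e i) g y).
  by apply/funext => y; apply: eq_bigr => i _; rewrite !mxE.
rewrite E; elim: (index_enum _) => [|i s IH].
  rewrite (_ : (fun _ => _) = cst 0); first exact: cst_continuous.
  by apply/funext => y; rewrite big_nil.
rewrite (_ : (fun _ => _) = (fun y => 'D_(e i) g y * 'D_(e i) g y
    + \sum_(j <- s) 'D_(e j) g y * 'D_(e j) g y)).
  have ci := (gA z Az i).2.
  by apply: cvgD; [apply: cvgM; exact: ci|exact: IH].
by apply/funext => y; rewrite big_cons.
Qed.

Section closure_class.
Variables (R : realType) (n : nat) (Omega : set 'rV[R]_n).
Hypothesis openO : open Omega.
Variable u0 : 'rV[R]_n -> R.
Hypothesis C0 : C_closure Omega 2 u0.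

Lemma C_closure_C1 : C1_along (@basis_vec R n) Omega u0.
Proof.
move=> z Oz i; have [/= [_ d] c] := C0.2 [:: i] isT.
by split; [exact: d|exact: (extends_continuous_at openO (@subset_closure _ _) c Oz)].
Qed.

Lemma C_closure_grad z : Omega z ->
  grad_bar Omega u0 z = grad_along (@basis_vec R n) u0 z.
Proof.
move=> Oz; apply/rowP => i; rewrite !mxE; have [_ c] := C0.2 [:: i] isT.
exact: (DbarE openO (@subset_closure _ _) c Oz).
Qed.

Lemma combine_basis v : combine (@basis_vec R n) v = v.
Proof. exact: row_sum_basis. Qed.
End closure_class.

Section cylinder_limits.
Variables (R : realType) (n : nat) (Omega : set 'rV[R]_n) (T : R).
Hypothesis T0 : 0 < T.
Hypothesis openO : open Omega.
Variable u : 'rV[R]_n * R -> R.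
Hypothesis Cu : C_parabolic Omega T 2 1 u.

Let A := open_cylinder Omega T.
Let B := closed_cylinder Omega T.

Let near_value z (eps : R) : B z -> 0 < eps ->
  nbhs z (fun y => B y -> `|u z - u y| <= eps).
Proof.
move=> Bz eps0; have /subspace_continuousP/(_ _ Bz) := Cu.1.
by move=> /cvgrPdist_le/(_ _ eps0).
Qed.

Lemma initial_time_limit x (eps : R) : Omega x -> 0 < eps ->
  exists2 r : R, 0 < r &
    forall t, 0 < t < r -> t <= T -> `|u (x, 0) - u (x, t)| <= eps.
Proof.
move=> Ox eps0.
have B0 : B (x, 0).
  by split => /=; [exact: subset_closure|rewrite in_itv /= lexx ltW].
have [r r0 Hr] := small_translate (dir_t R n) (near_value B0 eps0).
exists r => // t /andP[t0 tr] tT; have := Hr t; rewrite gtr0_norm // => /(_ tr).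
rewrite dir_t_line add0r; apply; split => /=; first exact: subset_closure.
by rewrite in_itv /= ltW.
Qed.

(** The initial Lipschitz bound holds on [Omega] and is needed on its closure,
    where the maximum of [doubled] at time 0 might sit. *)
Lemma closure_approx x (eps : R) : closure Omega x -> 0 < eps ->
  exists x', [/\ Omega x', `|u (x, 0) - u (x', 0)| <= eps & enorm (x - x') <= eps].
Proof.
move=> clx eps0.
have B0 z : closure Omega z -> B (z, 0).
  by move=> cz; split => //=; rewrite in_itv /= lexx ltW.
have H1 : nbhs x (fun x' => B (x', 0) -> `|u (x, 0) - u (x', 0)| <= eps).
  have [[P Q] [/= nP nQ] PQ] := near_value (B0 x clx) eps0.
  apply: filterS nP => x' Px'; apply: (PQ (x', 0)); split => //=.
  exact: nbhs_singleton nQ.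
have H2 : nbhs x (fun x' => enorm (x - x') <= eps).
  have cS : continuous (fun x' : 'rV[R]_n => x - x').
    by move=> z; apply: (@cvgB _ _ _ (nbhs z) _ (cst x) id); [exact: cvg_cst|exact: cvg_id].
  have ce : {for x, continuous (fun x' : 'rV[R]_n => enorm (x - x'))}.
    exact: (continuous_enorm cS).
  move: ce => /cvgrPdist_le/(_ _ eps0); apply: filterS => x'.
  have -> : enorm (x - x) = 0 by rewrite subrr -(scale0r x) enormZ normr0 mul0r.
  by rewrite sub0r normrN; apply: le_trans; exact: ler_norm.
have [x' [Ox' [h1 h2]]] := clx _ (filterI H1 H2).
by exists x'; split => //; apply: h1; apply: B0; exact: subset_closure.
Qed.

Lemma lipschitz_closure (M : R) : 0 <= M ->
  (forall x y, Omega x -> Omega y -> u (x, 0) - u (y, 0) <= M * enorm (x - y)) ->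
  forall x y, closure Omega x -> closure Omega y ->
    u (x, 0) - u (y, 0) <= M * enorm (x - y).
Proof.
move=> M0 H x y cx cy; apply/ler_addgt0Pr => eps eps0.
have d0 : 0 < 2 * M + 2 by lra.
have e0 : 0 < eps / (2 * M + 2) by rewrite divr_gt0.
set d := eps / _ in e0.
have dE : (2 * M + 2) * d = eps by rewrite /d mulrC divfK // gt_eqF.
have [x' [Ox' ux ex]] := closure_approx cx e0.
have [y' [Oy' uy ey]] := closure_approx cy e0.
have := H _ _ Ox' Oy'.
have tri : enorm (x' - y') <= enorm (x - y) + d + d.
  have -> : x' - y' = (x - y) + (- (x - x') + (y - y')).
    by apply/rowP => i; rewrite !mxE; ring.
  apply: le_trans (enormD _ _) _; rewrite -addrA lerD2l.
  by apply: le_trans (enormD _ _) _; rewrite enormN lerD.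
have := ler_wpM2l M0 tri; move: ux uy; rewrite !ler_norml => /andP[_ ux] /andP[uy _].
move: dE; lra.
Qed.

Lemma grad_slice_lipschitz (M t : R) x y : @convex_set R 'rV[R]_n Omega ->
  (forall z, A z -> enorm (grad_along (@dir_x R n) u z) <= M) ->
  0 < t < T -> Omega x -> Omega y -> u (x, t) - u (y, t) <= M * enorm (x - y).
Proof.
move=> cO HM tT Ox Oy.
have := @grad_bound_lipschitz R _ n (@dir_x R n) A u M (y, t) (x - y)
  (open_open_cylinder openO) (C_parabolic_C1 openO Cu) HM.
have E : (y, t) + combine (@dir_x R n) (x - y) = (x, t).
  by have := dir_x_line y (x - y) t 1; rewrite !scale1r (addrC y) subrK.
rewrite E; apply => s s01; rewrite dir_x_line; split => /=; last by rewrite in_itv.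
exact: convex_segment.
Qed.

Lemma slice_lipschitz_grad (M : R) : 0 <= M ->
  (forall x y t, Omega x -> Omega y -> 0 < t < T -> u (x, t) - u (y, t) <= M * enorm (x - y)) ->
  forall z, A z -> enorm (grad_along (@dir_x R n) u z) <= M.
Proof.
move=> M0 H [x t] Az; have [/= Ox] := Az; rewrite in_itv /= => tT.
apply: (lipschitz_grad_bound (open_open_cylinder openO) (C_parabolic_C1 openO Cu) Az M0).
move=> v s; rewrite dir_x_line => -[/= Os _].
by have := H _ _ _ Os Ox tT; rewrite addrAC subrr add0r.
Qed.

(** The final time lies outside the open cylinder, so the bound is passed to the
    limit from earlier times, tested against the limit gradient itself. *)
Lemma Dx_bound (M : R) :
  (forall z, A z -> enorm (grad_along (@dir_x R n) u z) <= M) ->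
  forall z, parabolic_cylinder Omega T z -> enorm (Dx Omega T u z) <= M.
Proof.
move=> HM [x t] [/= Ox]; rewrite in_itv /= => /andP[t0 tT].
have Bz : B (x, t).
  by split => /=; [exact: subset_closure|rewrite in_itv /= tT ltW].
set p := Dx Omega T u (x, t).
have [p0|p0] := eqVneq (enorm p) 0.
  have Axt2 : A (x, t / 2).
    by split => //=; rewrite in_itv /=; apply/andP; split; lra.
  by rewrite p0; apply: le_trans (HM _ Axt2); exact: enorm_ge0.
have pgt : 0 < enorm p by rewrite lt_neqAle eq_sym p0 enorm_ge0.
rewrite -(ler_pM2r pgt) -expr2 enorm_sqr; apply/ler_addgt0Pr => eps eps0.
have := @cvg_dotv_Dx R n Omega T u Cu (x, t) p Bz => /cvgrPdist_le/(_ _ eps0) H.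
pose D y := dotv (grad_along (@dir_x R n) u y) p.
have {H} : nbhs (x, t) (fun y => A y -> `|dotv p p - D y| <= eps) := H.
move=> /(small_translate (dir_t R n))[r r0 Hr].
pose s := Num.min (r / 2) (t / 2).
have s0 : 0 < s by rewrite lt_min !divr_gt0.
have sr : s < r by rewrite gt_min; apply/orP; left; lra.
have st : s < t by rewrite gt_min; apply/orP; right; lra.
have As : A (x, t - s).
  by split => //=; rewrite in_itv /=; apply/andP; split; lra.
have := Hr (- s); rewrite normrN gtr0_norm // dir_t_line => /(_ sr As).
rewrite ler_norml => /andP[_]; rewrite lerBlDl => /le_trans; apply.
rewrite lerD2r; apply: le_trans (dotv_le_enorm _ _) _.
by rewrite ler_pM2r // HM.
Qed.
End cylinder_limits.

(** * Equality of the norms *)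

Theorem theorem1p1 (R : realType) (n : nat) (hn : (1 <= n)%N)
    (Omega : set 'rV[R]_n)
    (hdom : is_domain Omega)
    (hbdd : bounded_set Omega)
    (hconv : @convex_set R 'rV[R]_n Omega)
    (hC2 : C2_boundary Omega)
    (nu : 'rV[R]_n -> 'rV[R]_n)
    (hnu : outer_unit_normal Omega nu)
    (T : R) (hT : 0 < T)
    (lambda Lambda : R) (hlambda : 0 < lambda) (hLambda : lambda <= Lambda)
    (f : R -> R) (hf : C_nonneg 3 f)
    (hell : forall s : R, 0 <= s ->
       lambda <= f s + 2 * s * Dbar (@pos_reals R) 1 f s <= Lambda)
    (q0 : R) (hq0 : n%:R + 2 < q0)
    (c : R -> R)
    (hcW : in_W1q 0 T q0 c)
    (hccont : {within `[0, T], continuous c})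
    (hcpos : forall t : R, 0 <= t <= T -> 0 <= c t)
    (u0 : 'rV[R]_n -> R)
    (hu0 : C_closure Omega 2 u0)
    (hu0N : forall x, frontier Omega x ->
       dotv (grad_bar Omega u0 x) (nu x) = 0)
    (u : 'rV[R]_n * R -> R)
    (hu : C_parabolic Omega T 2 1 u)
    (hsol : classical_solution Omega T nu f c u0 u) :
  Linfty_norm_xt (parabolic_cylinder Omega T) (fun z => enorm (Dx Omega T u z))
  = Linfty_norm Omega (fun x => enorm (grad_bar Omega u0 x)).
Proof.
have [openO [xO OxO] _] := hdom; have [pde neu init] := hsol.
have Cf : C_nonneg 1 f.
  by split; [exact: hf.1|move=> j j1; apply: hf.2; exact: leq_trans j1 _].
have ellf s : 0 <= s -> lambda <= f s + 2 * s * Dbar (@pos_reals R) 1 f s.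
  by move=> /hell /andP[].
have C1u0 := C_closure_C1 openO hu0.
have C1u := C_parabolic_C1 openO hu.
have oA := @open_open_cylinder R n Omega T openO.
have null0 m N : (0 < m)%N -> N = set0 -> lebesgue_null (N : set 'rV[R]_m).
  by case: m N => // m N _ ->; exact: lebesgue_null_set0.
have absE m (p : 'rV[R]_m) : `|enorm p| = enorm p by rewrite ger0_norm ?enorm_ge0.
have to_lip M : (forall x, Omega x -> enorm (grad_along (@basis_vec R n) u0 x) <= M) ->
    forall x y, Omega x -> Omega y -> u0 x - u0 y <= M * enorm (x - y).
  move=> HM x y Ox Oy.
  have := grad_bound_lipschitz (z := y) (v := x - y) openO C1u0 HM.
  rewrite combine_basis (addrC y) subrK; apply => s s01.
  exact: convex_segment.
apply: (f_equal (fun S : set R => ereal_inf [set M%:E | M in S])).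
apply/seteqP; split => M [M0 nullM]; (split; first exact: M0).
(* From the cylinder back to the initial time: the Lipschitz bound on each slice
   survives the limit t -> 0. *)
- have HM z : open_cylinder Omega T z -> enorm (grad_along (@dir_x R n) u z) <= M.
    move=> Az; rewrite leNgt; apply/negP => Mz.
    apply: (@lebesgue_null_space_time R n (parabolic_cylinder Omega T `&`
      [set y | M < `|enorm (Dx Omega T u y)|]) z); last exact: nullM.
    have /cvgr_gt/(_ _ Mz) := continuous_enorm_grad C1u Az.
    apply: filterS2 (open_nbhs_nbhs (conj oA Az)) => y Ay My.
    rewrite /= absE (C_parabolic_Dx openO hu Ay); split => //.
    case: Ay => /= Oy; rewrite !in_itv /= => /andP[y0 /ltW yT].
    by split => //=; rewrite in_itv /= y0.
  have lip x y : Omega x -> Omega y -> u0 x - u0 y <= M * enorm (x - y).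
    move=> Ox Oy; apply/ler_addgt0Pr => eps eps0.
    have e2 : 0 < eps / 2 by rewrite divr_gt0.
    have [r r0 Hr] := initial_time_limit hT hu Ox e2.
    have [q q_gt0 Hq] := initial_time_limit hT hu Oy e2.
    pose t := Num.min (r / 2) (Num.min (q / 2) (T / 2)).
    have t0 : 0 < t by rewrite !lt_min !divr_gt0.
    have tr : t < r by rewrite gt_min; apply/orP; left; lra.
    have tq : t < q by rewrite !gt_min; apply/orP; right; apply/orP; left; lra.
    have tT : t < T by rewrite !gt_min; apply/orP; right; apply/orP; right; lra.
    have := Hr t; rewrite t0 tr (ltW tT) => /(_ isT isT).
    have := Hq t; rewrite t0 tq (ltW tT) => /(_ isT isT).
    rewrite !init // !ler_norml => /andP[h1 _] /andP[_ h2].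
    have tTT : 0 < t < T by rewrite t0.
    have := grad_slice_lipschitz openO hu hconv HM tTT Ox Oy; lra.
  apply: null0 => //; apply/seteqP; split => // x [Ox /=].
  rewrite absE (C_closure_grad openO hu0 Ox) ltNge => /negP; apply.
  apply: (lipschitz_grad_bound openO C1u0 Ox M0) => v s; rewrite combine_basis => Os.
  by have := lip _ _ Os Ox; rewrite addrAC subrr add0r.
(* From the initial time to the cylinder, by [lipschitz_preserved]. *)
have HM x : Omega x -> enorm (grad_along (@basis_vec R n) u0 x) <= M.
  move=> Ox; rewrite leNgt; apply/negP => Mx.
  apply: (@lebesgue_null_nbhs R n _ x _ nullM).
  have /cvgr_gt/(_ _ Mx) := continuous_enorm_grad C1u0 Ox.
  apply: filterS2 (open_nbhs_nbhs (conj openO Ox)) => y Oy My.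
  by rewrite /= absE (C_closure_grad openO hu0 Oy).
have lip x y : Omega x -> Omega y -> u (x, 0) - u (y, 0) <= M * enorm (x - y).
  by move=> Ox Oy; rewrite !init //; exact: to_lip.
have lipc := lipschitz_closure hT hu M0 lip.
have lipt x y t : Omega x -> Omega y -> 0 < t < T ->
    u (x, t) - u (y, t) <= M * enorm (x - y).
  move=> Ox Oy tT; apply/ler_addgt0Pr => eps eps0.
  have e1 : 0 < enorm (x - y) + 1 by rewrite ltr_wpDl // enorm_ge0.
  (* [lipschitz_preserved] wants a positive constant, and M may vanish. *)
  pose L := M + eps / (enorm (x - y) + 1).
  have L0 : 0 < L by rewrite ltr_wpDl // divr_gt0.
  have lipL x' y' : closure Omega x' -> closure Omega y' ->
      u (x', 0) - u (y', 0) <= L * enorm (x' - y').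
    move=> cx cy; apply: le_trans (lipc _ _ cx cy) _.
    by rewrite ler_wpM2r ?enorm_ge0 // lerDl ltW // divr_gt0.
  have := lipschitz_preserved openO hbdd hconv hnu hu neu Cf hlambda ellf hcpos pde
    L0 tT lipL Ox Oy.
  move=> /le_trans; apply; rewrite /L mulrDl lerD2l mulrAC ler_pdivrMr //.
  by rewrite ler_pM2l // lerDl.
have HA := slice_lipschitz_grad openO hu M0 lipt.
apply: null0; first by rewrite addn1.
apply/seteqP; split => // z [/= Bz].
by rewrite absE ltNge (Dx_bound hu HA Bz).
Qed.
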